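(* Let $m\ge1$ and suppose $u_1,\ldots,u_m,v_1,\ldots,v_m$ satisfy $v_i>u_i>0$ for each $i$. Let $\delta=\sum_{i=1}^m(v_i-u_i)$, $p(c)=\prod_{i=1}^m(c+1-u_i)$, $q(c)=\prod_{i=1}^m(c+2-v_i)$, $q_1(c)=(1+c)q(c)-cq(c-1)$, $\nabla g(c)=g(c)-g(c-1)$, and for $0\le k\le m-1$ $$R_k'(\gamma)=\frac{1}{k!}\nabla^kp(\gamma)-\frac{1}{(k+1)!}\nabla^kq_1(\gamma).$$ Define $c_0=1$, $c_i=0$ for $i<0$, and for $n\ge1$ $$c_n=\frac1n\sum_{k=1}^{\min(m-1,n)}\frac{1}{(-n-\delta+1)_k}R'_{m-1-k}(n-k+\delta-1)\,c_{n-k}+\frac{1}{n(-n-\delta+1)_{m-1}}q(n-m+\delta-1)\,c_{n-m}.$$ Then there is a density function $f$ on $[0,1]$ with moment sequence $\int_0^1x^nf(x)\,dx=\prod_{i=1}^m\frac{(u_i)_n}{(v_i)_n}$, $n=0,1,2,\ldots$, and for $0<x\le1$ $$f(x)=\frac{1}{\Gamma(\delta)}\prod_{i=1}^m\frac{\Gamma(v_i)}{\Gamma(u_i)}(1-x)^{\delta-1}\left\{1+\sum_{n=1}^\infty c_n(1-x)^n\right\}.$$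
   Context: $(a)_n=\Gamma(a+n)/\Gamma(a)=a(a+1)\cdots(a+n-1)$ denotes the Pochhammer symbol; $\nabla$ acts on the argument $\gamma$ (so $\nabla^k$ is its $k$-fold iterate). A density function is a nonnegative integrable function on $[0,1]$ with integral 1. *)

(* Defs.v *)
From HB Require Import structures.
From mathcomp Require Import all_boot all_order all_algebra.
From mathcomp Require Import all_classical all_reals all_analysis.
Set Implicit Arguments. Unset Strict Implicit. Unset Printing Implicit Defensive.
Import Order.TTheory GRing.Theory Num.Theory.
Local Open Scope ring_scope.
Local Open Scope classical_set_scope.

Section Defs.
Variable R : realType.

Definition poch (a : R) (n : nat) : R := \prod_(j < n) (a + j%:R).

Definition Gamma (s : R) : R :=
  Rintegral (@lebesgue_measure R) `]0, +oo[ (fun t => t `^ (s - 1) * expR (- t)).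

Definition nabla (g : R -> R) : R -> R := fun c => g c - g (c - 1).

Variables (m : nat) (u v : 'I_m -> R).

Definition delta : R := \sum_(i < m) (v i - u i).
Definition pp (c : R) : R := \prod_(i < m) (c + 1 - u i).
Definition qq (c : R) : R := \prod_(i < m) (c + 2 - v i).
Definition qq1 (c : R) : R := (1 + c) * qq c - c * qq (c - 1).

Definition Rp (k : nat) (g : R) : R :=
  (k`!%:R)^-1 * iter k nabla pp g - (k.+1`!%:R)^-1 * iter k nabla qq1 g.

(* value c_{n-k} read from the history hist = [c_0; ...; c_{n-1}], 0 if n-k < 0 *)
Definition cget (hist : seq R) (n k : nat) : R :=
  if (k <= n)%N then nth 0 hist (n - k) else 0.

Definition cnext (hist : seq R) (n : nat) : R :=
  (n%:R)^-1 * \sum_(1 <= k < (minn (m - 1) n).+1)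
      (poch (- n%:R - delta + 1) k)^-1 * Rp (m - 1 - k) (n%:R - k%:R + delta - 1)
      * cget hist n k
  + (n%:R * poch (- n%:R - delta + 1) (m - 1))^-1
      * qq (n%:R - m%:R + delta - 1) * cget hist n m.

Fixpoint chist (n : nat) : seq R :=
  match n with
  | 0 => [:: 1]
  | n'.+1 => rcons (chist n') (cnext (chist n') n'.+1)
  end.

Definition cc (n : nat) : R := nth 0 (chist n) n.

End Defs.

(* Main.v *)
Require Import Defs.
From HB Require Import structures.
From mathcomp Require Import all_boot all_order all_algebra.
From mathcomp Require Import all_classical all_reals all_analysis.
From mathcomp Require Import measurable_realfun ring lra zify.
Set Implicit Arguments. Unset Strict Implicit. Unset Printing Implicit Defensive.
Import Order.TTheory GRing.Theory Num.Theory.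
Import numFieldNormedType.Exports.
Local Open Scope ring_scope.
Local Open Scope classical_set_scope.

(** The density is that of a product of independent beta variables of parameters
    u_i and v_i - u_i. Multiplying by one more beta variable is a Mellin convolution,
    and Tonelli's theorem multiplies the moments. Put y = 1 - x. In a convolution
    with a beta variable of parameters w and d = z - w, the function
    F = y^(delta - 1) sum_n a_n y^n becomes, up to a constant, x^(w - 1) I^d x^(1 - z) F,
    where I^d is the fractional integral of order d in y; integrating termwise and
    expanding the powers of x in binomial series shows that the new density again
    has the form y^(delta + d - 1) sum_n b_n y^n.

    To identify the coefficients, let theta = x d/dx. The densities satisfy
    prod_i (theta - (u_i - 1)) f = x prod_i (theta - (v_i - 2)) f, and this is
    proved by induction on m directly on coefficient sequences, from the commutation
    rules theta x^al = x^al (theta + al) and from the action of I^d. On powers of y,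
    a polynomial p(theta) acts through the backward differences nabla^k p / k!, so
    that comparing coefficients gives the recursion defining c_n. *)

Section pochhammer.
Context {R : realType}.
Implicit Types (c g : R) (n k : nat).

Lemma poch0 c : poch c 0 = 1. Proof. by rewrite /poch big_ord0. Qed.

Lemma pochS c n : poch c n.+1 = poch c n * (c + n%:R).
Proof. by rewrite /poch big_ord_recr. Qed.

Lemma pochSl c n : poch c n.+1 = c * poch (c + 1) n.
Proof.
rewrite /poch big_ord_recl addr0; congr (_ * _).
by apply: eq_bigr => i _; rewrite /bump/= natrD addrA.
Qed.

Lemma poch_gt0 c n : 0 < c -> 0 < poch c n.
Proof. by move=> c0; apply: prodr_gt0 => i _; rewrite ltr_wpDr. Qed.

Definition falling c k : R := \prod_(j < k) (c - j%:R).

Lemma falling0 c : falling c 0 = 1. Proof. by rewrite /falling big_ord0. Qed.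

Lemma fallingS c k : falling c k.+1 = falling c k * (c - k%:R).
Proof. by rewrite /falling big_ord_recr. Qed.

Lemma fallingSl c k : falling c k.+1 = c * falling (c - 1) k.
Proof.
rewrite /falling big_ord_recl subr0; congr (_ * _).
by apply: eq_bigr => i _; rewrite /bump/= natrD opprD addrA.
Qed.

Lemma fallingD1 c k : falling (c + 1) k.+1 = falling c k.+1 + k.+1%:R * falling c k.
Proof. by rewrite fallingSl addrK fallingS -natr1; ring. Qed.

Lemma poch_opp c k : poch (- c) k = (-1) ^+ k * falling c k.
Proof.
elim: k => [|k IHk]; first by rewrite poch0 falling0 mulr1.
by rewrite pochS IHk fallingS exprS; ring.
Qed.

Lemma poch_subn g n k : (k <= n)%N ->
  poch g n = poch g (n - k) * falling (n%:R + g - 1) k.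
Proof.
elim: k => [|k IHk] kn; first by rewrite falling0 mulr1 subn0.
rewrite IHk 1?ltnW// fallingS mulrA (mulrAC (poch _ _)); congr (_ * _).
have -> : (n - k = (n - k.+1).+1)%N by lia.
by rewrite pochS natrB// -(natr1 k); congr (_ * _); ring.
Qed.

Lemma poch_subn_opp g n k : 0 < g -> (k <= n)%N ->
  (-1) ^+ k * poch g (n - k) = poch g n / poch (- n%:R - g + 1) k.
Proof.
move=> g0 kn; have /lt0r_neq0 := poch_gt0 n g0.
rewrite (_ : - n%:R - g + 1 = - (n%:R + g - 1)) ?poch_opp; last by ring.
rewrite (poch_subn _ kn) mulf_eq0 negb_or => /andP[_ falling_neq0].
by rewrite invfM invr_sign; field.
Qed.

(* the coefficients of (1 - y) ^ (- c) *)
Definition negbin c k : R := poch c k / k`!%:R.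

Lemma natr_fact_neq0 k : k`!%:R != 0 :> R.
Proof. by rewrite pnatr_eq0 -lt0n fact_gt0. Qed.

Lemma negbin0 c : negbin c 0 = 1.
Proof. by rewrite /negbin poch0 fact0 divr1. Qed.

Lemma negbinS c k : k.+1%:R * negbin c k.+1 = (c + k%:R) * negbin c k.
Proof.
rewrite /negbin pochS factS natrM; field.
by rewrite natr_fact_neq0 addrC natr1 pnatr_eq0.
Qed.

Lemma negbinSl c k : k.+1%:R * negbin c k.+1 = c * negbin (c + 1) k.
Proof.
rewrite /negbin pochSl factS natrM; field.
by rewrite natr_fact_neq0 addrC natr1 pnatr_eq0.
Qed.

End pochhammer.

Section cauchy_product.
Context {R : realType}.
Implicit Types (x y : R^nat) (n k : nat).

Definition cauchyM x y n : R := \sum_(k < n.+1) x k * y (n - k)%N.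

Lemma series_cauchyM x y n :
  series (cauchyM x y) n = \sum_(i < n) x i * series y (n - i)%N.
Proof.
elim: n => [|n IHn]; first by rewrite /series/= big_nil big_ord0.
rewrite seriesSr IHn.
rewrite [cauchyM x y n]/cauchyM !big_ord_recr/= addrA -big_split/= subnn subSn// subnn.
congr (_ + _); last by rewrite /series/= big_nat1.
apply: eq_bigr => i _; rewrite subSn; last exact: ltnW.
by rewrite /series/= [in RHS]big_nat_recr//= mulrDr.
Qed.

Lemma mul_series x y n : series x n * series y n = \sum_(i < n) x i * series y n.
Proof. by rewrite -mulr_suml /series/= big_mkord. Qed.

Lemma norm_cauchyM_le x y n :
  `|cauchyM x y n| <= cauchyM (fun k => `|x k|) (fun k => `|y k|) n.
Proof.
by rewrite (le_trans (ler_norm_sum _ _ _))// ler_sum// => i _; rewrite normrM.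
Qed.

Section nonnegative.
Variables x y : R^nat.
Hypotheses (x0 : forall k, 0 <= x k) (y0 : forall k, 0 <= y k).

Lemma cauchyM_ge0 n : 0 <= cauchyM x y n.
Proof. by apply: sumr_ge0 => i _; exact: mulr_ge0. Qed.

Let series_ge0 (z : R^nat) n : (forall k, 0 <= z k) -> 0 <= series z n.
Proof. by move=> z0; apply: sumr_ge0. Qed.

Lemma series_cauchyM_le n : series (cauchyM x y) n <= series x n * series y n.
Proof.
rewrite series_cauchyM mul_series; apply: ler_sum => i _; rewrite ler_wpM2l//.
by apply: nondecreasing_series => //; exact: leq_subr.
Qed.

Lemma le_series_cauchyM n : series x n * series y n <= series (cauchyM x y) n.*2.
Proof.
rewrite series_cauchyM mul_series -(big_mkord xpredT (fun i => x i * series y n)).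
rewrite -(big_mkord xpredT (fun i => x i * series y (n.*2 - i)%N)).
rewrite [leRHS](@big_cat_nat _ _ _ n)//=; last by lia.
rewrite ler_wpDr//; first by apply: sumr_ge0 => i _; rewrite mulr_ge0// series_ge0.
apply: ler_sum_nat => i /andP[_ ni]; rewrite ler_wpM2l//.
by apply: nondecreasing_series => //; lia.
Qed.

Hypotheses (cx : cvgn (series x)) (cy : cvgn (series y)).

Lemma is_cvg_series_ge0_cauchyM : cvgn (series (cauchyM x y)).
Proof.
apply: nondecreasing_is_cvgn.
  by apply: nondecreasing_series => n _ _; exact: cauchyM_ge0.
exists (limn (series x) * limn (series y)) => _ [n _ <-].
rewrite (le_trans (series_cauchyM_le n))// ler_pM ?series_ge0//;
  by apply: nondecreasing_cvgn_le => //; exact: nondecreasing_series.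
Qed.

Lemma cvg_mul_series_sub_cauchyM :
  series x n * series y n - series (cauchyM x y) n @[n --> \oo] --> 0.
Proof.
have cC := is_cvg_series_ge0_cauchyM.
rewrite -(subrr (limn (series (cauchyM x y)))); apply: cvgB => //.
apply: (@squeeze_cvgr _ _ _ _ (series (cauchyM x y))
         (fun n => series (cauchyM x y) n.*2)) => //.
  by apply: nearW => n; rewrite series_cauchyM_le le_series_cauchyM.
apply: (cvg_comp (fun n => n.*2) (series (cauchyM x y)) _ cC).
by move=> A [N _ NA]; exists N => //= n /= Nn; apply: NA => /=; lia.
Qed.

End nonnegative.

(* The defect of the partial sums is dominated by that of the norms, which tends
   to 0 because the terms are nonnegative there. *)
Lemma cvg_series_cauchyM x y :
  cvgn [normed series x] -> cvgn [normed series y] ->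
  series (cauchyM x y) @ \oo --> limn (series x) * limn (series y).
Proof.
move=> cx cy; apply: cvg_sub0 (cvgM (normed_cvg cx) (normed_cvg cy)).
apply/cvgr0Pnorm_lt => e e0.
have /cvgr0Pnorm_lt/(_ e e0) := cvg_mul_series_sub_cauchyM
  (fun k => normr_ge0 (x k)) (fun k => normr_ge0 (y k)) cx cy.
apply: filterS => n; apply: le_lt_trans.
rewrite (_ : (_ - _) n = series (cauchyM x y) n - series x n * series y n)//.
have defectE (a b : R^nat) : series a n * series b n - series (cauchyM a b) n =
    \sum_(i < n) a i * (series b n - series b (n - i)%N).
  rewrite series_cauchyM mul_series -sumrB.
  by apply: eq_bigr => i _; rewrite mulrBr.
rewrite distrC !defectE (le_trans (ler_norm_sum _ _ _))// (le_trans _ (ler_norm _))//.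
apply: ler_sum => i _; rewrite normrM ler_wpM2l//.
by rewrite !sub_series_geq ?leq_subr//; exact: ler_norm_sum.
Qed.

End cauchy_product.

Section power_series.
Context {R : realType}.
Implicit Types (a b : R^nat) (c r s : R) (n : nat).

Definition radius_ge1 a :=
  forall r, 0 <= r < 1 -> cvgn (pseries (fun n => `|a n|) r).

Lemma radius_ge1_normed a r : radius_ge1 a -> 0 <= r < 1 ->
  cvgn [normed series (fun n => a n * r ^+ n)].
Proof.
move=> a1 /[dup] r01 /a1; rewrite /pseries /normed_series_of/=.
rewrite (_ : (fun n => `|a n| * r ^+ n) = (fun n => `|a n * r ^+ n|))//.
by apply/funext => n; rewrite normrM normrX [`|r|]ger0_norm//; case/andP: r01.
Qed.

Lemma radius_ge1_cvg a r : radius_ge1 a -> 0 <= r < 1 -> cvgn (pseries a r).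
Proof. by move=> a1 r01; apply: normed_cvg; exact: radius_ge1_normed. Qed.

Lemma radius_ge1_le a b : radius_ge1 b ->
  (forall n, `|a n| <= `|b n|) -> radius_ge1 a.
Proof.
move=> b1 ab r r01; have /andP[r0 _] := r01.
apply: series_le_cvg (b1 r r01) => n; rewrite ?mulr_ge0 ?exprn_ge0//.
by rewrite ler_wpM2r ?exprn_ge0.
Qed.

Lemma radius_ge1_cst c : radius_ge1 (fun=> c).
Proof.
move=> r /andP[r0 r1]; apply: is_cvg_geometric_series.
by rewrite ger0_norm.
Qed.

Lemma cauchyM_exprn a b r n :
  cauchyM a b n * r ^+ n = cauchyM (fun k => a k * r ^+ k) (fun k => b k * r ^+ k) n.
Proof.
rewrite /cauchyM mulr_suml; apply: eq_bigr => i _.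
by rewrite mulrACA -exprD subnKC// -ltnS.
Qed.

Lemma radius_ge1_cauchyM a b :
  radius_ge1 a -> radius_ge1 b -> radius_ge1 (cauchyM a b).
Proof.
move=> a1 b1 r r01; have /andP[r0 _] := r01.
have term_ge0 (c : R^nat) k : 0 <= `|c k| * r ^+ k by rewrite mulr_ge0 ?exprn_ge0.
have := is_cvg_series_ge0_cauchyM (term_ge0 a) (term_ge0 b) (a1 _ r01) (b1 _ r01).
apply: series_le_cvg => n; first exact: term_ge0.
  exact/cauchyM_ge0.
by rewrite -cauchyM_exprn ler_wpM2r ?exprn_ge0// norm_cauchyM_le.
Qed.

Lemma lim_pseries_cauchyM a b r : radius_ge1 a -> radius_ge1 b -> 0 <= r < 1 ->
  limn (pseries (cauchyM a b) r) = limn (pseries a r) * limn (pseries b r).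
Proof.
move=> a1 b1 r01; apply/cvg_lim => //; rewrite /pseries.
under eq_fun do rewrite cauchyM_exprn.
by apply: cvg_series_cauchyM; exact: radius_ge1_normed.
Qed.

Lemma cvg_pseriesZ c a r (l : R) : pseries a r @ \oo --> l ->
  pseries (fun n => c * a n) r @ \oo --> c * l.
Proof.
move=> al; rewrite (_ : pseries _ _ = fun n => c * pseries a r n).
  by apply: cvgM => //; exact: cvg_cst.
apply/funext => n; rewrite [RHS]mulr_sumr.
by apply: eq_bigr => i _; rewrite mulrA.
Qed.

Lemma lim_pseries0 a : limn (pseries a 0) = a 0%N.
Proof.
apply/cvg_lim => //; rewrite -cvg_shiftS; apply: cvg_near_cst; apply: nearW => n.
rewrite /pseries /series/= big_nat_recl//= expr0 mulr1 big1 ?addr0// => i _.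
by rewrite exprS mul0r mulr0.
Qed.

Lemma pseries_tail a r : cvgn (pseries a r) ->
  series (fun n => a n.+1 * r ^+ n.+1) @ \oo --> limn (pseries a r) - a 0%N.
Proof.
move=> ca; rewrite (_ : series _ = fun n => pseries a r n.+1 - a 0%N).
  by apply: cvgB; [rewrite (cvg_shiftS (pseries a r))|exact: cvg_cst].
apply/funext => n; rewrite /pseries /series/= [in RHS]big_nat_recl//=.
by rewrite expr0 mulr1 addrC addrA addNr add0r.
Qed.

Lemma norm_pseries_le a r s n : radius_ge1 a -> 0 <= r <= s -> s < 1 ->
  `|pseries a r n| <= limn (pseries (fun k => `|a k|) s).
Proof.
move=> a1 /andP[r0 rs] s1; have s0 := le_trans r0 rs.
apply: (@le_trans _ _ (pseries (fun k => `|a k|) s n)).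
  rewrite (le_trans (ler_norm_sum _ _ _))//; apply: ler_sum => i _.
  by rewrite normrM ler_wpM2l// normrX lerXn2r ?nnegrE// ger0_norm.
apply: nondecreasing_cvgn_le; last by apply: a1; rewrite s0.
by apply: nondecreasing_series => i _ _; rewrite mulr_ge0 ?exprn_ge0.
Qed.

End power_series.

Lemma gt0_mulr_powRB1 {R : realType} (c x : R) : 0 < x -> x * x `^ (c - 1) = x `^ c.
Proof.
move=> x0; rewrite -[X in X * _](powRr1 (ltW x0)) -powRD ?(gt_eqF x0) ?implybT//.
by congr (_ `^ _); ring.
Qed.

Section negative_binomial_series.
Context {R : realType}.
Implicit Types (c r y : R) (n k N : nat).

Lemma pseries_diffs_negbin c : pseries_diffs (negbin c) = (fun n => c * negbin (c + 1) n).
Proof. by apply/funext => n; rewrite /pseries_diffs negbinSl. Qed.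

Lemma negbinD1 c : negbin (c + 1) = cauchyM (negbin c) (fun=> 1).
Proof.
apply/funext; elim=> [|n IHn]; first by rewrite /cauchyM big_ord1 !negbin0 mulr1.
rewrite /cauchyM big_ord_recr mulr1/= -/(cauchyM (negbin c) (fun=> 1) n) -IHn.
have n0 : n.+1%:R != 0 :> R by rewrite pnatr_eq0.
by apply: (mulfI n0); rewrite negbinS mulrDr negbinSl -natr1; ring.
Qed.

Lemma radius_ge1_negbin_natr N : radius_ge1 (negbin N%:R : R^nat).
Proof.
elim: N => [|N IHN]; last first.
  by rewrite -natr1 negbinD1; apply: radius_ge1_cauchyM => //; exact: radius_ge1_cst.
apply: radius_ge1_le (@radius_ge1_cst R 1) _ => -[|n]; first by rewrite negbin0.
by rewrite /negbin pochSl !mul0r normr0.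
Qed.

Lemma norm_negbin_le c N n : `|c| <= N%:R -> `|negbin c n| <= negbin N%:R n.
Proof.
move=> cN; rewrite /negbin normrM normfV normr_nat ler_wpM2r//.
rewrite /poch normr_prod ler_prod// => i _; rewrite normr_ge0/=.
by rewrite (le_trans (ler_normD _ _))// normr_nat lerD2r.
Qed.

Lemma radius_ge1_negbin c : radius_ge1 (negbin c).
Proof.
pose N := (Num.truncn `|c|).+1.
apply: radius_ge1_le (@radius_ge1_negbin_natr N) _ => n.
by rewrite (le_trans (norm_negbin_le _ _) (ler_norm _))// ltW// truncnS_gt.
Qed.

Lemma lim_pseries_negbinD1 c r : 0 <= r < 1 ->
  limn (pseries (negbin c) r) = (1 - r) * limn (pseries (negbin (c + 1)) r).
Proof.
move=> r01; have /andP[r0 r1] := r01.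
rewrite negbinD1 lim_pseries_cauchyM//; last 2 first.
  exact: radius_ge1_negbin.
  exact: radius_ge1_cst.
have -> : limn (pseries (fun=> 1) r) = (1 - r)^-1.
  rewrite -[RHS]mul1r; apply/cvg_lim => //; apply: cvg_geometric_series.
  by rewrite ger0_norm.
by rewrite mulrCA mulfV ?mulr1// subr_eq0 gt_eqF.
Qed.

Lemma is_derive_pseries_negbin c y : `|y| < 1 ->
  is_derive y (1 : R) (fun z => limn (pseries (negbin c) z))
    (c * limn (pseries (negbin (c + 1)) y)).
Proof.
move=> y1; pose K := (`|y| + 1) / 2; have y0 := normr_ge0 y.
have K01 : 0 <= K < 1 by rewrite /K; lra.
have yK : `|y| < `|K| by rewrite [`|K|]ger0_norm /K; lra.
have cvgK d := radius_ge1_cvg (@radius_ge1_negbin d) K01.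
have diffs2E : pseries_diffs (fun n => c * negbin (c + 1) n) =
    fun n => (c * (c + 1)) * negbin (c + 1 + 1) n.
  by apply/funext => n; rewrite /pseries_diffs mulrCA negbinSl mulrA.
have := @pseries_snd_diffs _ (negbin c) K y (cvgK c).
rewrite !pseries_diffs_negbin diffs2E.
have cvgZ e d : cvgn (pseries (fun n => e * negbin d n) K).
  exact: cvgP (cvg_pseriesZ (cvgK d)).
move=> /(_ (cvgZ _ _) (cvgZ _ _) yK).
rewrite (cvg_lim _ (cvg_pseriesZ (is_cvg_pseries_inside (cvgK _) yK)))//.
Qed.

Lemma is_derive_onem_powR c y : y < 1 ->
  is_derive y (1 : R) (fun z => (1 - z) `^ c) (- (c * (1 - y) `^ (c - 1))).
Proof.
move=> y1; have onem_gt0 : 0 < 1 - y by rewrite subr_gt0.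
have d_onem : is_derive y (1 : R) (fun z : R => 1 - z) (-1).
  by apply: is_derive_eq; rewrite add0r mul1r.
have := @is_derive1_comp _ (@powR R ^~ c) (fun z => 1 - z) y _ _
  (is_derive1_powR c onem_gt0) d_onem.
by rewrite mulrN1.
Qed.

(* (1 - y) ^ c times the series is constant on [0, r], its derivative being 0 by
   the relation between the series of parameters c and c + 1. *)
Lemma lim_pseries_negbin c r : 0 <= r < 1 ->
  limn (pseries (negbin c) r) = (1 - r) `^ (- c).
Proof.
move=> /andP[r0 r1].
pose S d (y : R) : R := limn (pseries (negbin d) y).
pose F (y : R) : R := (1 - y) `^ c * S c y.
pose F' (y : R) : R :=
  (1 - y) `^ c * (c * S (c + 1) y) + S c y * - (c * (1 - y) `^ (c - 1)).
have dF (y : R) : 0 <= y <= r -> is_derive y (1 : R) F (F' y).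
  move=> /andP[y0 yr]; have y1 := le_lt_trans yr r1.
  have dS : is_derive y (1 : R) (S c) (c * S (c + 1) y).
    by apply: is_derive_pseries_negbin; rewrite ger0_norm.
  have d_powR := is_derive_onem_powR c y1; exact: is_deriveM.
have F'0 (y : R) : 0 <= y <= r -> F' y = 0.
  move=> /andP[y0 yr]; have y1 := le_lt_trans yr r1.
  by rewrite /F' /S (lim_pseries_negbinD1 c) ?y0// -(gt0_mulr_powRB1 c) ?subr_gt0//; ring.
have [||y y0r] := @MVT_segment _ F F' 0 r r0.
- by move=> y /subset_itv_oo_cc; rewrite in_itv/= => y0r; exact: dF.
- apply: derivable_within_continuous => y; rewrite in_itv/= => y0r.
  by have d := dF y y0r.
rewrite F'0 ?mul0r; last by move: y0r; rewrite in_itv.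
move=> /eqP; rewrite subr_eq0 => /eqP.
rewrite /F /S lim_pseries0 negbin0 subr0 powR1 mulr1 => FrE.
have onem_neq0 : (1 - r) `^ c != 0 by rewrite gt_eqF// powR_gt0// subr_gt0.
by apply: (mulfI onem_neq0); rewrite FrE powRN mulfV.
Qed.

End negative_binomial_series.

Section theta_operators.
Context {R : realType}.
Implicit Types (g p al : R) (a b : int -> R) (P Q : seq R) (n : int) (k K : nat).

(* A sequence [a] stands for the sum of the [a n * y ^ (n + g - 1) / Gamma (n + g)]
   with x = 1 - y; [thetaB g p] is then the operator x d/dx - p, and [mulY], [mulX]
   are the multiplications by y and x. Since d/dy is a shift in this basis, the
   operators make sense for every g, including the integers, and the fractional
   integral of order d only replaces g by g + d. *)
Definition thetaB g p a n : R := (n%:~R + g - 1 - p) * a n - a (n + 1).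
Definition mulY g a n : R := (n%:~R + g - 1) * a (n - 1).
Definition mulX g a n : R := a n - mulY g a n.
Definition theta_prod g P a : int -> R := foldr (thetaB g) a P.
Definition hypergeom_eq g P Q a : Prop :=
  theta_prod g P a =1 mulX g (theta_prod g Q a).

(* [b] is the product of [a] by x ^ al = (1 - y) ^ al; the expansion in powers of y
   is finite at every index because [a] vanishes below [L]. *)
Definition mulXpow g al a b : Prop := exists2 L : int,
  (forall n, n < L -> a n = 0) &
  (forall n K, n < L + K%:Z ->
    b n = \sum_(k < K) negbin (- al) k * (falling (n%:~R + g - 1) k * a (n - k%:Z))).

Lemma mulXpow_unique g al a b b' : mulXpow g al a b -> mulXpow g al a b' -> b =1 b'.
Proof.
move=> [L _ bE] [L' _ b'E] n.
have [K [nK nK']] : exists K : nat, n < L + K%:Z /\ n < L' + K%:Z.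
  by exists (absz (n - L)%R + absz (n - L')%R).+1; lia.
by rewrite (bE n K)// (b'E n K).
Qed.

Lemma mulXpow_mulX g al a b : mulXpow g al a b -> mulXpow g al (mulX g a) (mulX g b).
Proof.
move=> [L a0 bE]; exists L => [n nL|n K nK].
  by rewrite /mulX /mulY !a0 ?mulr0 ?subr0//; lia.
rewrite [LHS]/mulX [mulY g b n]/mulY (bE n K) ?(bE (n - 1) K); [|lia..].
rewrite mulr_sumr -sumrB; apply: eq_bigr => k _.
have fallingE : (n%:~R + g - 1) * falling ((n - 1)%:~R + g - 1) k =
    falling (n%:~R + g - 1) k * (n%:~R + g - 1 - k%:R).
  by rewrite -fallingS fallingSl rmorphB/=; congr (_ * falling _ _); ring.
rewrite [(n%:~R + g - 1) * _](_ : _ = negbin (- al) k *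
    (falling (n%:~R + g - 1) k * (n%:~R + g - 1 - k%:R) * a (n - 1 - k%:Z))).
  by rewrite /mulX /mulY [n - k%:Z - 1]addrAC rmorphB/=; ring.
by rewrite -fallingE; ring.
Qed.

Lemma mulXpow_thetaB g al p a b : mulXpow g al a b ->
  mulXpow g al (thetaB g p a) (thetaB g (p + al) b).
Proof.
move=> [L a0 bE]; exists (L - 1) => [n nL|n K nK].
  by rewrite /thetaB !a0 ?mulr0 ?subr0//; lia.
rewrite [LHS]/thetaB (bE n K) ?(bE (n + 1) K); [|lia..].
pose x := n%:~R + g - 1.
pose e k := k%:R * negbin (- al) k * falling x k.-1 * a (n + 1 - k%:Z).
transitivity (\sum_(k < K) (negbin (- al) k * (falling x k * thetaB g p a (n - k%:Z))
    + (e k.+1 - e k))).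
  rewrite mulr_sumr -sumrB; apply: eq_bigr => k _; rewrite /e negbinS /thetaB.
  rewrite (_ : n + 1 - k.+1%:Z = n - k%:Z); last by lia.
  rewrite (_ : n - k%:Z + 1 = n + 1 - k%:Z); last by lia.
  rewrite (_ : (n + 1)%:~R + g - 1 = x + 1); last by rewrite /x rmorphD/=; ring.
  rewrite rmorphB/= -/x; case: (k : nat) => [|j] /=; last rewrite fallingD1.
    by rewrite !falling0 /x; ring.
  by rewrite /x; ring.
rewrite big_split/= [X in _ + X](_ : _ = 0) ?addr0//.
rewrite -(big_mkord xpredT (fun k => e k.+1 - e k)) telescope_sumr//.
rewrite /e !mul0r subr0; case: K nK => [|K] nK; first by rewrite !mul0r.
by rewrite a0 ?mulr0//; lia.
Qed.

Lemma mulXpow_theta_prod g al P a b : mulXpow g al a b ->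
  mulXpow g al (theta_prod g P a) (theta_prod g [seq p + al | p <- P] b).
Proof. by move=> ab; elim: P => //= p P IHP; exact: mulXpow_thetaB. Qed.

Lemma hypergeom_eq_mulXpow g al P Q a b : mulXpow g al a b ->
  hypergeom_eq g P Q a ->
  hypergeom_eq g [seq p + al | p <- P] [seq q + al | q <- Q] b.
Proof.
move=> ab aE; have := mulXpow_theta_prod P ab; rewrite (funext aE).
by move=> /mulXpow_unique; apply; exact/mulXpow_mulX/mulXpow_theta_prod.
Qed.

Lemma theta_prod_shift g d P a :
  theta_prod g P a =1 theta_prod (g + d) [seq p + d | p <- P] a.
Proof.
elim: P => //= p P IHP n; rewrite /thetaB !IHP; congr (_ * _ - _); ring.
Qed.

Lemma hypergeom_eq_shift g d P Q a : hypergeom_eq g P Q a ->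
  hypergeom_eq (g + d) (0 :: [seq p + d | p <- P]) (d - 1 :: [seq q + d | q <- Q]) a.
Proof.
move=> aE n; rewrite /= /mulX /mulY /thetaB -!theta_prod_shift !aE /mulX /mulY.
by rewrite addrK subrK !rmorphB !rmorphD/=; ring.
Qed.

Lemma hypergeom_eq_beta g u v P Q a c b :
  mulXpow g (1 - v) a c -> mulXpow (g + (v - u)) (u - 1) c b ->
  hypergeom_eq g P Q a ->
  hypergeom_eq (g + (v - u)) (u - 1 :: P) (v - 2 :: Q) b.
Proof.
move=> ac cb aE.
have := hypergeom_eq_mulXpow cb (hypergeom_eq_shift (v - u) (hypergeom_eq_mulXpow ac aE)).
rewrite /= -!map_comp !(@eq_map _ _ _ id) ?map_id => [|p /=|p /=]; [|ring..].
by rewrite add0r (_ : v - u - 1 + (u - 1) = v - 2)//; ring.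
Qed.

End theta_operators.

Section backward_differences.
Context {R : realType}.
Implicit Types (g p c : R) (f : R -> R) (a : int -> R) (P Q : seq R) (n : int) (k K : nat).

Local Arguments nabla {R} g c.

Definition nnabla k f c : R := (k`!%:R)^-1 * iter k nabla f c.

Lemma iter_nabla_mulBl k p f c :
  iter k nabla (fun x => (x - p) * f x) c =
  (c - k%:R - p) * iter k nabla f c + k%:R * iter k.-1 nabla f c.
Proof.
elim: k c => [|k IHk] c; first by rewrite /= mul0r addr0 subr0.
rewrite iterS /nabla !IHk.
case: k {IHk} => [|k] /=; first by rewrite /nabla; ring.
by rewrite /nabla -[k.+2%:R]natr1; ring.
Qed.

Lemma nnabla0 f c : nnabla 0 f c = f c.
Proof. by rewrite /nnabla fact0 invr1 mul1r. Qed.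

Lemma nnablaS_mulBl k p f c : nnabla k.+1 (fun x => (x - p) * f x) c =
  (c - k.+1%:R - p) * nnabla k.+1 f c + nnabla k f c.
Proof.
rewrite /nnabla iter_nabla_mulBl factS natrM; field.
by rewrite natr_fact_neq0 addrC natr1 pnatr_eq0.
Qed.

Definition linprod P c : R := \prod_(p <- P) (c - p).

Lemma linprod_cons p P : linprod (p :: P) = fun c => (c - p) * linprod P c.
Proof. by apply/funext => c; rewrite /linprod big_cons. Qed.

Lemma nnabla_linprod_gt k P c : (size P < k)%N -> nnabla k (linprod P) c = 0.
Proof.
elim: P k c => [|p P IHP] [//|k] c /= Pk; last first.
  by rewrite linprod_cons nnablaS_mulBl !IHP ?mulr0 ?addr0//; lia.
rewrite /nnabla iterSr (_ : nabla _ = fun=> 0); last first.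
  by apply/funext => x; rewrite /nabla /linprod !big_nil subrr.
suff -> : iter k nabla (fun=> 0 : R) = fun=> 0 by rewrite mulr0.
by elim: k {Pk} => //= k ->; apply/funext => x; rewrite /nabla subrr.
Qed.

Lemma nnabla_linprod_size P c : nnabla (size P) (linprod P) c = 1.
Proof.
elim: P => [|p P IHP] /=; first by rewrite nnabla0 /linprod big_nil.
by rewrite linprod_cons nnablaS_mulBl IHP nnabla_linprod_gt// mulr0 add0r.
Qed.

Lemma nnabla_linprod_size_pred p P c : nnabla (size P) (linprod (p :: P)) c =
  \sum_(j < (size P).+1) (c - j%:R) - \sum_(x <- p :: P) x.
Proof.
elim: P p => [|q P IHP] p.
  by rewrite nnabla0 /linprod !big_cons !big_nil big_ord1/=; ring.
rewrite /= linprod_cons nnablaS_mulBl (nnabla_linprod_size (q :: P)) IHP.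
by rewrite [in RHS]big_ord_recr/= [in RHS]big_cons; ring.
Qed.

Lemma theta_prodE g P a n K : (size P < K)%N -> theta_prod g P a n =
  \sum_(k < K) (-1) ^+ k * nnabla k (linprod P) (n%:~R + g - 1 + k%:R) * a (n + k%:Z).
Proof.
elim: P n K => [|p P IHP] n [//|K] /= PK.
  rewrite big_ord_recl/= big1 ?addr0 => [|k _]; last first.
    by rewrite nnabla_linprod_gt// mulr0 mul0r.
  by rewrite nnabla0 /linprod big_nil expr0 !mul1r.
rewrite /thetaB (IHP _ K.+1) 1?ltnW// (IHP _ K)//.
rewrite [in RHS]big_ord_recl [in LHS]big_ord_recl /= linprod_cons.
rewrite !nnabla0 mulrDr mulr_sumr -addrA -sumrB; congr (_ + _).
  by rewrite !addr0; ring.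
apply: eq_bigr => k _; rewrite /bump/= !add1n nnablaS_mulBl.
rewrite (_ : n + 1 + k%:Z = n + k.+1%:Z); last by lia.
rewrite (_ : (n + 1)%:~R + g - 1 + k%:R = n%:~R + g - 1 + k.+1%:R); last first.
  by rewrite rmorphD/= -natr1; ring.
by rewrite exprS; ring.
Qed.

Definition recur_coef k P Q c : R := nnabla k (linprod P) c
  - nnabla k (linprod Q) c - (c - k%:R) * nnabla k.+1 (linprod Q) c.

Lemma recur_coef_size P Q c : size P = size Q -> recur_coef (size P) P Q c = 0.
Proof.
move=> PQ; rewrite /recur_coef nnabla_linprod_size PQ nnabla_linprod_size.
by rewrite nnabla_linprod_gt//; ring.
Qed.

Lemma recur_coef_size_pred m P Q c : size P = m.+1 -> size Q = m.+1 ->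
  recur_coef m P Q c = \sum_(x <- Q) x - \sum_(x <- P) x - (c - m%:R).
Proof.
case: P Q => [//|p P] [//|q Q] [Pm] [Qm]; rewrite /recur_coef.
have := nnabla_linprod_size (q :: Q) c; rewrite /= Qm => ->.
have := nnabla_linprod_size_pred p P c; rewrite Pm => ->.
by have := nnabla_linprod_size_pred q Q c; rewrite Qm => ->; ring.
Qed.

Lemma hypergeom_eq_expand g P Q a n : size P = size Q -> hypergeom_eq g P Q a ->
  \sum_(k < size P) (-1) ^+ k * recur_coef k P Q (n%:~R + g - 1 + k%:R) * a (n + k%:Z)
  + (n%:~R + g - 1) * linprod Q (n%:~R + g - 2) * a (n - 1) = 0.
Proof.
move=> PQ /(_ n); rewrite /mulX /mulY; set m := size P.
have mQ : (size Q < m.+1)%N by rewrite /m PQ.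
rewrite (theta_prodE _ _ _ (ltnSn m)) (theta_prodE _ _ n mQ).
rewrite (theta_prodE _ _ (n - 1) (leqW mQ)).
rewrite [X in _ - _ * X]big_ord_recl/= nnabla0 !addr0 expr0 mul1r => /eqP.
rewrite -subr_eq0 => /eqP aE; rewrite -[RHS]aE.
transitivity (\sum_(k < m.+1) (-1) ^+ k * recur_coef k P Q (n%:~R + g - 1 + k%:R)
    * a (n + k%:Z) + (n%:~R + g - 1) * linprod Q (n%:~R + g - 2) * a (n - 1)).
  by rewrite big_ord_recr/= recur_coef_size// mulr0 mul0r addr0.
rewrite opprB addrA addrAC -sumrB mulrDr addrA mulr_sumr addrAC -big_split/=.
congr (_ + _).
  apply: eq_bigr => k _; rewrite /bump/= add1n /recur_coef.
  rewrite (_ : (n - 1 + k.+1%:Z = n + k%:Z)); last by lia.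
  rewrite (_ : (n - 1)%:~R + g - 1 + k.+1%:R = n%:~R + g - 1 + k%:R); last first.
    by rewrite rmorphB/= -natr1; ring.
  by rewrite exprS; ring.
by rewrite mulrA; congr (_ * linprod _ _ * _); rewrite rmorphB/=; ring.
Qed.

Lemma hypergeom_eq_expand_rev g m P Q a n : size P = m.+1 -> size Q = m.+1 ->
  hypergeom_eq g P Q a ->
  \sum_(k < m.+1) (-1) ^+ k * recur_coef (m - k) P Q (n%:~R - k%:R + g - 1) * a (n - k%:Z)
  + (-1) ^+ m * (n%:~R - m.+1%:R + g) * linprod Q (n%:~R - m.+1%:R + g - 1)
    * a (n - m.+1%:Z) = 0.
Proof.
move=> Pm Qm /(hypergeom_eq_expand (n - m%:Z)); rewrite Pm Qm => /(_ erefl).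
move=> /(congr1 (fun x => (-1) ^+ m * x)); rewrite mulr0 => aE; rewrite -[RHS]aE.
rewrite [RHS]mulrDr [X in _ = X + _]mulr_sumr (reindex_inj rev_ord_inj)/=.
congr (_ + _); last first.
  rewrite (_ : n - m%:Z - 1 = n - m.+1%:Z); last by lia.
  rewrite -(natr1 m) rmorphB/=.
  rewrite (_ : n%:~R - m%:~R + g - 2 = n%:~R - (m%:R + 1) + g - 1); last by ring.
  by ring.
apply: eq_bigr => k _; have km : (k <= m)%N by rewrite -ltnS.
rewrite subSS subKn// (_ : n - (m - k)%N%:Z = n - m%:Z + k%:Z); last by lia.
rewrite natrB// [(n - m%:Z)%:~R + g - 1 + k%:R](_ : _ =
  n%:~R - (m%:R - k%:R) + g - 1); last by rewrite rmorphB/=; ring.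
have signE : (-1) ^+ m * (-1) ^+ k = (-1) ^+ (m - k) :> R.
  by rewrite -{1}(subnK km) exprD -mulrA -expr2 sqrr_sign mulr1.
by rewrite -signE; ring.
Qed.

End backward_differences.

Section gamma_coordinates.
Context {R : realType}.
Implicit Types (g d al : R) (c : R^nat) (n k : nat).

Definition zero_extend c (n : int) : R := if n is Posz k then c k else 0.

(* the sequence standing for Gamma(g)^-1 times the sum of the c n * y ^ (n + g - 1) *)
Definition gamma_coord g c (n : int) : R := if n is Posz k then poch g k * c k else 0.

Lemma gamma_coord_lt0 g c (n : int) : n < 0 -> gamma_coord g c n = 0.
Proof. by case: n. Qed.

Lemma zero_extend_lt0 c (n : int) : n < 0 -> zero_extend c n = 0.
Proof. by case: n. Qed.

Lemma gamma_coord_sub g c n k : 0 < g ->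
  (-1) ^+ k * gamma_coord g c (n%:Z - k%:Z) =
  poch g n * ((poch (- n%:R - g + 1) k)^-1 * zero_extend c (n%:Z - k%:Z)).
Proof.
move=> g0; have [kn|nk] := leqP k n; last first.
  by rewrite gamma_coord_lt0 ?zero_extend_lt0 ?mulr0//; lia.
by rewrite subzn//= mulrA poch_subn_opp// mulrA.
Qed.

Lemma gamma_coord_subS g c n k : 0 < g ->
  (-1) ^+ k * (n%:R - k.+1%:R + g) * gamma_coord g c (n%:Z - k.+1%:Z) =
  poch g n * ((poch (- n%:R - g + 1) k)^-1 * zero_extend c (n%:Z - k.+1%:Z)).
Proof.
move=> g0; have [kn|nk] := leqP k.+1 n; last first.
  by rewrite gamma_coord_lt0 ?zero_extend_lt0 ?mulr0//; lia.
rewrite subzn//= [RHS]mulrA -poch_subn_opp ?(ltnW kn)//.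
rewrite (_ : (n - k = (n - k.+1).+1)%N); last by lia.
by rewrite pochS natrB//; ring.
Qed.

Lemma mulXpow_gamma_coord g al c :
  mulXpow g al (gamma_coord g c) (gamma_coord g (cauchyM (negbin (- al)) c)).
Proof.
exists 0 => [n|n K]; first exact: gamma_coord_lt0.
rewrite add0r; case: n => n nK; last first.
  by rewrite big1// => k _; rewrite [gamma_coord _ _ (_ - _)]gamma_coord_lt0 ?mulr0//; lia.
rewrite -(big_mkord xpredT (fun k => negbin (- al) k *
  (falling (n%:~R + g - 1) k * gamma_coord g c (n%:Z - k%:Z)))).
rewrite (@big_cat_nat _ _ _ n.+1)//=.
rewrite [X in _ + X]big_nat_cond [X in _ + X]big1 ?addr0; last first.
  by move=> k kn; rewrite gamma_coord_lt0 ?mulr0//; lia.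
rewrite big_mkord /cauchyM mulr_sumr; apply: eq_bigr => k _.
have kn : (k <= n)%N by rewrite -ltnS.
by rewrite subzn//= (poch_subn _ kn); ring.
Qed.

Definition beta_ratio d g c : R^nat := fun j => c j * (poch g j / poch (d + g) j).

Lemma radius_ge1_beta_ratio d g c : 0 < d -> 0 <= g ->
  radius_ge1 c -> radius_ge1 (beta_ratio d g c).
Proof.
move=> d0 g0 /radius_ge1_le; apply => n; rewrite normrM ler_piMr//.
have poch_dg_gt0 : 0 < poch (d + g) n by rewrite poch_gt0// ltr_wpDr.
rewrite normrM normfV [`|poch (d + g) n|]gtr0_norm// ler_pdivrMr// mul1r.
rewrite /poch normr_prod ler_prod// => i _; rewrite normr_ge0/= ger0_norm ?addr_ge0//.
by rewrite lerD2r lerDr ltW.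
Qed.

Lemma gamma_coord_beta_ratio d g c : 0 < d -> 0 <= g ->
  gamma_coord (g + d) (beta_ratio d g c) = gamma_coord g c.
Proof.
move=> d0 g0; apply/funext => -[n|//] /=; rewrite /beta_ratio [d + g]addrC.
have /lt0r_neq0 : 0 < poch (g + d) n by rewrite poch_gt0// ltr_wpDl.
by move: (poch (g + d) n) => x x0; field.
Qed.

End gamma_coordinates.

Section recurrence.
Context {R : realType} {m : nat} (u v : 'I_m -> R).
Implicit Types (c : R^nat) (n k : nat).

Definition recurrence_rhs c n : R :=
  \sum_(1 <= k < m) (poch (- n%:R - delta u v + 1) k)^-1
    * Rp u v (m - 1 - k) (n%:R - k%:R + delta u v - 1) * zero_extend c (n%:Z - k%:Z)
  + (poch (- n%:R - delta u v + 1) (m - 1))^-1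
    * qq v (n%:R - m%:R + delta u v - 1) * zero_extend c (n%:Z - m%:Z).

Lemma size_chist n : size (chist u v n) = n.+1.
Proof. by elim: n => //= n IHn; rewrite size_rcons IHn. Qed.

Lemma nth_chist n k : (k <= n)%N -> nth 0 (chist u v n) k = cc u v k.
Proof.
elim: n => [|n IHn]; first by case: k.
rewrite leq_eqVlt => /predU1P[->//|kn].
by rewrite /= nth_rcons size_chist kn IHn.
Qed.

Lemma cget_chist n k : (0 < k)%N ->
  cget (chist u v n) n.+1 k = zero_extend (cc u v) (n.+1%:Z - k%:Z).
Proof.
move=> k0; rewrite /cget; case: ifPn => [kn|]; last first.
  by rewrite -ltnNge => nk; rewrite zero_extend_lt0//; lia.
by rewrite nth_chist ?subzn//; lia.
Qed.

Lemma cc_recurrence n : (0 < m)%N ->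
  n.+1%:R * cc u v n.+1 = recurrence_rhs (cc u v) n.+1.
Proof.
move=> m0; have n0 : n.+1%:R != 0 :> R by rewrite pnatr_eq0.
rewrite /cc /= nth_rcons size_chist ltnn eqxx /cnext cget_chist// mulrDr mulVKf//.
rewrite invfM !mulrA mulfV// mul1r; congr (_ + _).
rewrite [RHS](@big_cat_nat _ _ _ (minn (m - 1) n.+1).+1)//=; last by lia.
rewrite [X in _ = _ + X]big_nat_cond [X in _ = _ + X]big1 ?addr0; last first.
  by move=> k km; rewrite zero_extend_lt0 ?mulr0//; lia.
by apply: eq_big_nat => k /andP[k0 _]; rewrite cget_chist.
Qed.

Lemma recurrence_unique c c' : (0 < m)%N -> c 0%N = c' 0%N ->
  (forall n, n.+1%:R * c n.+1 = recurrence_rhs c n.+1) ->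
  (forall n, n.+1%:R * c' n.+1 = recurrence_rhs c' n.+1) -> c =1 c'.
Proof.
move=> m0 c0 cE c'E; elim/ltn_ind => -[//|n] IHn.
have n0 : n.+1%:R != 0 :> R by rewrite pnatr_eq0.
have extE k : (0 < k)%N ->
    zero_extend c (n.+1%:Z - k%:Z) = zero_extend c' (n.+1%:Z - k%:Z).
  move=> k0; have [kn|nk] := leqP k n.+1; last by rewrite !zero_extend_lt0//; lia.
  by rewrite subzn//= IHn//; lia.
apply: (mulfI n0); rewrite cE c'E /recurrence_rhs extE//; congr (_ + _).
by apply: eq_big_nat => k /andP[k0 _]; rewrite extE.
Qed.

Definition pp_roots : seq R := [seq u i - 1 | i <- enum 'I_m].
Definition qq_roots : seq R := [seq v i - 2 | i <- enum 'I_m].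

Lemma linprod_pp_roots : linprod pp_roots = pp u.
Proof.
apply/funext => x; rewrite /linprod /pp big_map big_enum/=.
by apply: eq_bigr => i _; ring.
Qed.

Lemma linprod_qq_roots : linprod qq_roots = qq v.
Proof.
apply/funext => x; rewrite /linprod /qq big_map big_enum/=.
by apply: eq_bigr => i _; ring.
Qed.

Lemma sum_roots_sub : \sum_(x <- qq_roots) x - \sum_(x <- pp_roots) x = delta u v - m%:R.
Proof.
have sum1 : \sum_(i < m) 1 = m%:R :> R by rewrite sumr_const card_ord.
rewrite big_map big_enum big_map big_enum/= -sum1 -!sumrB.
by apply: eq_bigr => i _; ring.
Qed.

Lemma RpE k x : Rp u v k x = recur_coef k pp_roots qq_roots x.
Proof.
rewrite /Rp /recur_coef linprod_pp_roots linprod_qq_roots -addrA; congr (_ + _).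
have -> : qq1 v = nabla (fun x => (x - (-1)) * qq v x).
  by apply/funext => y; rewrite /qq1 /nabla; ring.
rewrite -iterSr -/(nnabla k.+1 _ x) nnablaS_mulBl -natr1; ring.
Qed.

End recurrence.

Lemma delta_gt0 {R : realType} {m : nat} (u v : 'I_m -> R) :
  (0 < m)%N -> (forall i, u i < v i) -> 0 < delta u v.
Proof.
case: m u v => // m u v _ uv; rewrite /delta big_ord_recl ltr_pwDl ?subr_gt0//.
by apply: sumr_ge0 => i _; rewrite subr_ge0 ltW.
Qed.

Lemma hypergeom_eq_recurrence {R : realType} {m : nat} (u v : 'I_m -> R) (c : nat -> R) n :
  (0 < m)%N -> 0 < delta u v ->
  hypergeom_eq (delta u v) (pp_roots u) (qq_roots v) (gamma_coord (delta u v) c) ->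
  n%:R * c n = recurrence_rhs u v c n.
Proof.
case: m u v => // m u v _; set g := delta u v => g0 cE.
have sP : size (pp_roots u) = m.+1 by rewrite size_map size_enum_ord.
have sQ : size (qq_roots v) = m.+1 by rewrite size_map size_enum_ord.
have pn0 : poch g n != 0 by rewrite gt_eqF// poch_gt0.
have top_coefE : Rp u v m (n%:R + g - 1) = - n%:R.
  by rewrite RpE (recur_coef_size_pred _ sP sQ) sum_roots_sub -/g -natr1; ring.
have := hypergeom_eq_expand_rev n%:Z sP sQ cE.
rewrite linprod_qq_roots -!pmulrn mulrAC gamma_coord_subS//.
under eq_bigr do rewrite mulrAC gamma_coord_sub// -!mulrA -RpE.
rewrite -mulr_sumr -mulrA -mulrDr => /eqP; rewrite mulf_eq0 (negPf pn0)/=.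
rewrite -(big_mkord xpredT (fun k => (poch (- n%:R - g + 1) k)^-1 *
  (zero_extend c (n%:Z - k%:Z) * Rp u v (m - k) (n%:R - k%:R + g - 1)))).
rewrite big_ltn// subn0 !subr0 top_coefE poch0 invr1 mul1r /= -addrA.
rewrite mulrN addrC subr_eq0 eq_sym mulrC => /eqP ->.
rewrite /recurrence_rhs -/g subn1 /=; congr (_ + _); last by rewrite mulrAC.
by apply: eq_big_nat => k _; rewrite mulrA mulrAC.
Qed.

Lemma hypergeom_eq_cc {R : realType} {m : nat} (u v : 'I_m -> R) (c : nat -> R) :
  (0 < m)%N -> 0 < delta u v -> c 0%N = 1 ->
  hypergeom_eq (delta u v) (pp_roots u) (qq_roots v) (gamma_coord (delta u v) c) ->
  c =1 cc u v.
Proof.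
move=> m0 g0 c0 cE; apply: (recurrence_unique m0) => [|n|n].
- by rewrite c0.
- exact: (hypergeom_eq_recurrence n.+1 m0 g0 cE).
- exact: cc_recurrence.
Qed.

Section beta_product_coefficients.
Context {R : realType}.
Implicit Types (g w z : R) (a : R^nat) (ps : seq (R * R)).

(* In the convolution of y ^ (g - 1) * sum_n a_n y ^ n with a beta kernel of
   parameters w and z - w: multiplication by x ^ (1 - z), termwise integration
   against (1 - s) ^ (g - 1), multiplication by x ^ (w - 1). *)
Definition beta_conv_coef g w z a : R^nat :=
  cauchyM (negbin (1 - w)) (beta_ratio (z - w) g (cauchyM (negbin (z - 1)) a)).

Lemma beta_conv_coef0 g w z a : beta_conv_coef g w z a 0%N = a 0%N.
Proof.
rewrite /beta_conv_coef /cauchyM big_ord1 subnn /beta_ratio big_ord1.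
by rewrite !negbin0 !poch0 divr1 mulr1 !mul1r.
Qed.

Lemma radius_ge1_beta_conv_coef g w z a : 0 <= g -> w < z ->
  radius_ge1 a -> radius_ge1 (beta_conv_coef g w z a).
Proof.
move=> g0 wz a1; apply: radius_ge1_cauchyM; first exact: radius_ge1_negbin.
apply: radius_ge1_beta_ratio; rewrite ?subr_gt0//.
by apply: radius_ge1_cauchyM => //; exact: radius_ge1_negbin.
Qed.

Lemma hypergeom_eq_beta_conv_coef g w z P Q a : 0 <= g -> w < z ->
  hypergeom_eq g P Q (gamma_coord g a) ->
  hypergeom_eq (g + (z - w)) (w - 1 :: P) (z - 2 :: Q)
    (gamma_coord (g + (z - w)) (beta_conv_coef g w z a)).
Proof.
move=> g0 wz; have d0 : 0 < z - w by rewrite subr_gt0.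
have := mulXpow_gamma_coord g (1 - z) a; rewrite opprB => ac.
have := mulXpow_gamma_coord (g + (z - w)) (w - 1)
  (beta_ratio (z - w) g (cauchyM (negbin (z - 1)) a)).
by rewrite gamma_coord_beta_ratio// opprB => cb; exact: hypergeom_eq_beta ac cb.
Qed.

Definition sum_gaps ps : R := \sum_(p <- ps) (p.2 - p.1).
Definition beta_params ps : bool := all (fun p => 0 < p.1 < p.2) ps.

Lemma beta_params_cons w z ps :
  beta_params ((w, z) :: ps) = (0 < w < z) && beta_params ps.
Proof. by []. Qed.

Lemma sum_gaps_cons w z ps : sum_gaps ((w, z) :: ps) = sum_gaps ps + (z - w).
Proof. by rewrite /sum_gaps big_cons addrC. Qed.

Lemma sum_gaps_ge0 ps : beta_params ps -> 0 <= sum_gaps ps.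
Proof.
elim: ps => [_|[w z] ps IHps /= /andP[/andP[_ wz] /IHps gap_ge0]].
  by rewrite /sum_gaps big_nil.
by rewrite sum_gaps_cons addr_ge0// subr_ge0 ltW.
Qed.

Lemma sum_gaps_gt0 p ps : beta_params (p :: ps) -> 0 < sum_gaps (p :: ps).
Proof.
case: p => w z /= /andP[/andP[_ wz] /sum_gaps_ge0 gap_ge0].
by rewrite sum_gaps_cons ltr_wpDl// subr_gt0.
Qed.

(* The empty product is the point mass at x = 1, the limit of y ^ (g - 1) / Gamma g
   as g tends to 0. *)
Fixpoint beta_prod_coef ps : R^nat :=
  if ps is (w, z) :: ps' then beta_conv_coef (sum_gaps ps') w z (beta_prod_coef ps')
  else fun n => (n == 0)%N%:R.

Lemma beta_prod_coef0 ps : beta_prod_coef ps 0%N = 1.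
Proof. by elim: ps => //= -[w z] ps IHps; rewrite beta_conv_coef0. Qed.

Lemma beta_prod_coef1 w z : beta_prod_coef [:: (w, z)] = negbin (1 - w).
Proof.
have cauchyM_delta0 a (c : R^nat) : a =1 (fun n => (n == 0)%N%:R) -> cauchyM c a = c.
  move=> aE; apply/funext => n; rewrite /cauchyM big_ord_recr/= subnn aE mulr1.
  by rewrite big1 ?add0r// => i _; rewrite aE subn_eq0 leqNgt ltn_ord mulr0.
rewrite /= /beta_conv_coef /sum_gaps big_nil cauchyM_delta0// => -[|n].
  by rewrite /beta_ratio /cauchyM big_ord1 subnn negbin0 !poch0 divr1 !mulr1.
by rewrite /beta_ratio pochSl !mul0r mulr0.
Qed.

Lemma radius_ge1_beta_prod_coef ps : beta_params ps -> radius_ge1 (beta_prod_coef ps).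
Proof.
elim: ps => [_|[w z] ps IHps /= /andP[/andP[_ wz] psP]].
  by apply: radius_ge1_le (@radius_ge1_cst R 1) _ => -[|n]; rewrite ?normr0.
exact: radius_ge1_beta_conv_coef (sum_gaps_ge0 psP) wz (IHps psP).
Qed.

Lemma hypergeom_eq_beta_prod_coef ps : beta_params ps ->
  hypergeom_eq (sum_gaps ps) [seq p.1 - 1 | p <- ps] [seq p.2 - 2 | p <- ps]
    (gamma_coord (sum_gaps ps) (beta_prod_coef ps)).
Proof.
elim: ps => [_|[w z] ps IHps /= /andP[/andP[_ wz] psP]]; last first.
  rewrite sum_gaps_cons.
  exact: hypergeom_eq_beta_conv_coef (sum_gaps_ge0 psP) wz (IHps psP).
move=> n; rewrite /sum_gaps big_nil /mulX /mulY /= addr0.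
have [->|n1] := eqVneq n 1; first by rewrite subrr mul0r subr0.
suff -> : gamma_coord 0 (beta_prod_coef [::]) (n - 1) = 0 by rewrite mulr0 subr0.
by case nE : (n - 1) => [[|k]|k] //=; [lia|rewrite mulr0].
Qed.

Lemma beta_prod_coef_cc m (u v : 'I_m -> R) (ps := [seq (u i, v i) | i <- enum 'I_m]) :
  (0 < m)%N -> 0 < delta u v -> beta_params ps -> beta_prod_coef ps = cc u v.
Proof.
move=> m0 gap_gt0 psP; have gapsE : sum_gaps ps = delta u v.
  by rewrite /sum_gaps big_map big_enum.
have pp_rootsE : [seq p.1 - 1 | p <- ps] = pp_roots u by rewrite -map_comp.
have qq_rootsE : [seq p.2 - 2 | p <- ps] = qq_roots v by rewrite -map_comp.
apply/funext; apply: (hypergeom_eq_cc m0 gap_gt0 (beta_prod_coef0 ps)).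
by have := hypergeom_eq_beta_prod_coef psP; rewrite gapsE pp_rootsE qq_rootsE.
Qed.

End beta_product_coefficients.

Section lebesgue_integral_tools.
Context {R : realType}.
Local Notation mu := (@lebesgue_measure R).
Implicit Types (a b c d l t x : R) (f g F : R -> R) (n : nat).

Lemma measurable_in_itv (i : interval R) :
  measurable_fun [set: R] (fun t => (t \in i)%:R : R).
Proof.
rewrite (_ : (fun _ => _) = \1_([set` i] : set R)); first exact: measurable_indic.
by apply/funext => t; rewrite indicE mem_setE.
Qed.

Lemma integral_itv_mkcond (i : interval R) f :
  (\int[mu]_(t in [set` i]) (f t)%:E = \int[mu]_t ((t \in i)%:R * f t)%:E)%E.
Proof.
rewrite integral_mkcond; apply: eq_integral => t _; rewrite patchE mem_setE.
by case: ifP => _; rewrite ?mul1r ?mul0r.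
Qed.

Lemma exprn_mul_ge0 f n x : (forall t, 0 <= f t) -> (forall t, t <= 0 -> f t = 0) ->
  0 <= x ^+ n * f x.
Proof.
move=> f0 f_le0; have [/f_le0->|x0] := leP x 0; first by rewrite mulr0.
by rewrite mulr_ge0// exprn_ge0// ltW.
Qed.

Lemma measurable_exprn_mul f n : measurable_fun [set: R] f ->
  measurable_fun [set: R] (fun x => x ^+ n * f x).
Proof. by move=> mf; apply: measurable_funM => //; exact: exprn_measurable. Qed.

Lemma ge0_integral_affine c d (f : R -> \bar R) : 0 < c ->
  measurable_fun [set: R] f -> (forall x, 0 <= f x)%E ->
  (\int[mu]_x f x = c%:E * \int[mu]_x f (c * x + d)%R)%E.
Proof.
move=> c0 mf f0; pose affine (x : measurableTypeR R) : measurableTypeR R := c * x + d.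
have maffine : measurable_fun [set: measurableTypeR R] affine.
  by apply: measurable_funD => //; exact: measurable_funM.
have [nu nuE] : exists nu : {measure set (measurableTypeR R) -> \bar R},
    (nu : set _ -> \bar R) = pushforward mu affine.
  by unshelve refine (ex_intro _ _ (erefl (pushforward mu affine))).
rewrite (@eq_measure_integral _ _ _ _ (mscale (NngNum (ltW c0)) nu)).
  rewrite ge0_integral_mscale//=; congr (_ * _)%E.
  by rewrite nuE ge0_integral_pushforward//= preimage_setT.
move=> A mA _; apply: lebesgue_measure_unique mA => X [[a b] _ <-] /=.
rewrite /mscale/= nuE /pushforward lebesgue_measure_itv/=.
have -> : affine @^-1` `]a, b] = `](a - d) / c, (b - d) / c].
  by apply/seteqP; split=> x /=;
    rewrite !in_itv/= /affine ltr_pdivrMr// ler_pdivlMr// [x * c]mulrC ltrBlDr lerBrDr.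
rewrite lebesgue_measure_itv/= !lte_fin ltr_pM2r ?invr_gt0// ltrD2r.
case: ifPn => _; last by rewrite mule0.
by rewrite -!EFinB -EFinM; congr EFin; field; rewrite gt_eqF.
Qed.

Lemma ge0_continuous_FTC2oc f F a b l : a < b ->
  (forall x, a < x <= b -> 0 <= f x) ->
  {within `]a, b], continuous f} ->
  F x @[x --> a^'+] --> l -> {in `]a, b[%R, forall x, derivable F x 1} ->
  F x @[x --> b^'-] --> F b -> {in `]a, b[%R, F^`() =1 f} ->
  (\int[mu]_(x in `]a, b]) (f x)%:E = (F b)%:E - l%:E)%E.
Proof.
move=> ab f0 cf Fa dF Fb F'f; pose e n : R := a + n.+1%:R^-1.
have ae n : a < e n by rewrite ltrDl invr_gt0.
have subitv n : `[e n, b] `<=` `]a, b].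
  by move=> x /=; rewrite !in_itv/= => /andP[/(lt_le_trans (ae n))-> ->].
have mf : measurable_fun `]a, b] (EFin \o f).
  by apply/measurable_EFinP; apply: subspace_continuous_measurable_fun.
have cvg_e : e @ \oo --> a.
  by rewrite -[X in _ --> X]addr0; apply: cvgD; [exact: cvg_cst|exact: cvg_harmonic].
have integral_e n : e n < b ->
    (\int[mu]_(x in `[e n, b]) (f x)%:E = (F b - F (e n))%:E)%E.
  move=> eb; have ae_itv x : x \in `]e n, b[%R -> x \in `]a, b[%R.
    by rewrite !in_itv/= => /andP[/(lt_trans (ae n))-> ->].
  apply: continuous_FTC2 => //.
  - exact: continuous_subspaceW cf.
  - split=> //; first by move=> x /ae_itv/dF.
    apply/cvg_at_right_filter/differentiable_continuous/derivable1_diffP/dF.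
    by rewrite in_itv/= ae.
  - by move=> x /ae_itv/F'f.
pose D n : set (measurableTypeR R) := `[e n, b].
rewrite itv_open_bnd_bigcup -EFinB -[\bigcup_n _]/(\bigcup_n D n).
have cvg_integral : (\int[mu]_(x in D n) (f x)%:E)%E @[n --> \oo] -->
    (\int[mu]_(x in \bigcup_n D n) (f x)%:E)%E.
  apply: ge0_nondecreasing_set_cvg_integral.
  - apply/nondecreasing_seqP => n; rewrite subsetEset => x; rewrite /D/= !in_itv/=.
    move=> /andP[ex ->]; rewrite andbT (le_trans _ ex)// lerD2l lef_pV2 ?posrE//.
    by rewrite ler_nat.
  - by move=> n; exact: measurable_itv.
  - by move=> n; apply: measurable_funS mf => //; exact: subitv.
  - by move=> n x /subitv /=; rewrite in_itv/= lee_fin => /f0.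
apply: cvg_unique cvg_integral _ => //.
have cvg_Fe : (F b - F (e n))%:E @[n --> \oo] --> (F b - l)%:E.
  apply: cvg_EFin; first exact: nearW.
  by apply: cvgB; [exact: cvg_cst|move/cvg_at_rightP : Fa; apply].
apply: cvg_trans cvg_Fe; apply: near_eq_cvg.
by near=> n; rewrite /= integral_e//; near: n; apply: (cvgr_lt a).
Unshelve. all: end_near. Qed.

Lemma ge0_integral_convolution f g :
  measurable_fun [set: R] f -> measurable_fun [set: R] g ->
  (forall x, 0 <= f x) -> (forall x, 0 <= g x) ->
  (\int[mu]_x \int[mu]_t (f t * g (x - t))%:E =
   \int[mu]_x (f x)%:E * \int[mu]_x (g x)%:E)%E.
Proof.
move=> mf mg f0 g0.
have translateE t : (\int[mu]_x (g x)%:E = \int[mu]_x (g (x - t))%:E)%E.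
  rewrite (@ge0_integral_affine 1 (- t)) ?mul1e//; last exact/measurable_EFinP.
  by apply: eq_integral => x _; rewrite mul1r.
pose h (z : R * R) : \bar R := (f z.2 * g (z.1 - z.2))%:E.
have mh : measurable_fun setT h.
  apply/measurable_EFinP; apply: measurable_funM.
    exact: (@measurableT_comp _ _ _ _ _ _ f).
  by apply: (@measurableT_comp _ _ _ _ _ _ g) => //; exact: measurable_funB.
have h0 z : (0 <= h z)%E by rewrite lee_fin mulr_ge0.
rewrite [LHS](@fubini_tonelli _ _ _ _ _ mu mu h mh h0).
rewrite -ge0_integralZr//.
- apply: eq_integral => t _; rewrite {1}(translateE t) -ge0_integralZl//.
  + by apply/measurable_EFinP/measurableT_comp => //; exact: measurable_funB.
  + by move=> x _; rewrite lee_fin.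
  + by rewrite lee_fin.
- exact/measurable_EFinP.
- by move=> x _; rewrite lee_fin.
- by apply: integral_ge0 => x _; rewrite lee_fin.
Qed.

End lebesgue_integral_tools.

Section mellin_convolution.
Context {R : realType}.
Local Notation mu := (@lebesgue_measure R).
Variables F K : R -> R.

(* the density of the product of independent variables of densities F and K *)
Definition mellin_conv (x : R) : \bar R :=
  (\int[mu]_t (F t * (t^-1 * K (x / t)))%:E)%E.

Hypotheses (mF : measurable_fun [set: R] F) (mK : measurable_fun [set: R] K).
Hypotheses (F0 : forall t, 0 <= F t) (K0 : forall t, 0 <= K t).
Hypotheses (F_le0 : forall t, t <= 0 -> F t = 0) (K_le0 : forall t, t <= 0 -> K t = 0).
Let integrand (q : R * R) : R := F q.2 * (q.2^-1 * K (q.1 / q.2)).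

Lemma mellin_integrand_ge0 x t : 0 <= F t * (t^-1 * K (x / t)).
Proof.
have [/F_le0->|t0] := leP t 0; first by rewrite mul0r.
by rewrite !mulr_ge0// invr_ge0 ltW.
Qed.

Lemma mellin_integrand_le0 x t : x <= 0 -> F t * (t^-1 * K (x / t)) = 0.
Proof.
move=> x0; have [/F_le0->|t0] := leP t 0; first by rewrite mul0r.
by rewrite K_le0 ?mulr0// pmulr_lle0 ?invr_gt0.
Qed.

Lemma mellin_conv_ge0 x : (0 <= mellin_conv x)%E.
Proof. by apply: integral_ge0 => t _; rewrite lee_fin mellin_integrand_ge0. Qed.

Lemma mellin_conv_le0 x : x <= 0 -> mellin_conv x = 0%E.
Proof. by move=> x0; apply: integral0_eq => t _; rewrite mellin_integrand_le0. Qed.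

Lemma measurable_mellin_integrand : measurable_fun [set: R * R] integrand.
Proof.
have -> : integrand = fun q => F q.2 * (q.2 `^ (-1) * K (q.1 * q.2 `^ (-1))).
  apply/funext => -[x t]; rewrite /integrand/=.
  have [/F_le0->|t0] := leP t 0; first by rewrite !mul0r.
  by rewrite powR_inv1// ltW.
have mpow : measurable_fun [set: R * R] (fun q : R * R => q.2 `^ (-1)).
  by apply: (@measurableT_comp _ _ _ _ _ _ (@powR R ^~ (-1))) => //; exact: measurable_snd.
apply: measurable_funM; first exact: (@measurableT_comp _ _ _ _ _ _ F).
apply: measurable_funM => //; apply: (@measurableT_comp _ _ _ _ _ _ K) => //.
exact: measurable_funM.
Qed.

Lemma measurable_mellin_integrandr x :
  measurable_fun [set: R] (fun t => F t * (t^-1 * K (x / t))).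
Proof.
apply: (@measurableT_comp _ _ _ _ _ _ integrand _ (pair x)) => //.
exact: measurable_mellin_integrand.
Qed.

Let exprn_mul_integrand_ge0 n x t : 0 <= x ^+ n * integrand (x, t).
Proof.
apply: (exprn_mul_ge0 (f := fun y => integrand (y, t))) => y.
  exact: mellin_integrand_ge0.
exact: mellin_integrand_le0.
Qed.

Let integral_exprn_integrand n t : (\int[mu]_x (x ^+ n * integrand (x, t))%:E =
  (t ^+ n * F t)%:E * \int[mu]_s (s ^+ n * K s)%:E)%E.
Proof.
have [/F_le0 Ft0|t0] := leP t 0.
  by rewrite Ft0 mulr0 mul0e integral0_eq// => x _; rewrite /integrand/= Ft0 mul0r mulr0.
rewrite (@ge0_integral_affine _ t 0)//; first last.
- by move=> x; rewrite lee_fin exprn_mul_integrand_ge0.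
- apply/measurable_EFinP; apply: (@measurable_exprn_mul _ (fun x => integrand (x, t))).
  exact: (measurableT_comp measurable_mellin_integrand).
have scaledE x : (t * x + 0) ^+ n * integrand (t * x + 0, t) =
    t^-1 * (t ^+ n * F t) * (x ^+ n * K x).
  by rewrite addr0 /integrand/= (mulrC t x) mulfK ?gt_eqF// exprMn; ring.
under eq_integral do rewrite scaledE EFinM.
rewrite ge0_integralZl//.
- by rewrite muleA -EFinM mulVKf// gt_eqF.
- by apply/measurable_EFinP; apply: measurable_exprn_mul.
- by move=> x _; rewrite lee_fin exprn_mul_ge0.
- by rewrite lee_fin !mulr_ge0 ?exprn_ge0 ?invr_ge0 ?(ltW t0).
Qed.

Lemma integral_exprn_mellin_conv n :
  (\int[mu]_x ((x ^+ n)%:E * mellin_conv x) =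
   \int[mu]_t (t ^+ n * F t)%:E * \int[mu]_s (s ^+ n * K s)%:E)%E.
Proof.
pose h (q : R * R) : \bar R := (q.1 ^+ n * integrand q)%:E.
have mh : measurable_fun setT h.
  apply/measurable_EFinP; apply: measurable_funM; last exact: measurable_mellin_integrand.
  by apply: (@measurableT_comp _ _ _ _ _ _ (fun x : R => x ^+ n)).
have h0 q : (0 <= h q)%E by case: q => x t; rewrite lee_fin exprn_mul_integrand_ge0.
transitivity (\int[mu]_x \int[mu]_t h (x, t))%E.
  apply: eq_integral => x _; have [x0|x0] := leP x 0.
    rewrite mellin_conv_le0// mule0 integral0_eq// => t _.
    by rewrite /h /integrand mellin_integrand_le0 ?mulr0.
  rewrite -ge0_integralZl//.
  - by apply/measurable_EFinP; exact: measurable_mellin_integrandr.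
  - by move=> t _; rewrite lee_fin mellin_integrand_ge0.
  - by rewrite lee_fin exprn_ge0// ltW.
rewrite [LHS](@fubini_tonelli _ _ _ _ _ mu mu h mh h0).
under eq_integral do rewrite integral_exprn_integrand.
rewrite ge0_integralZr//.
- by apply/measurable_EFinP; apply: measurable_exprn_mul.
- by move=> t _; rewrite lee_fin exprn_mul_ge0.
- by apply: integral_ge0 => s _; rewrite lee_fin exprn_mul_ge0.
Qed.

End mellin_convolution.

Section gamma_and_beta_integrals.
Context {R : realType}.
Local Notation mu := (@lebesgue_measure R).
Implicit Types (a b r s t x : R) (n : nat).

Definition gamma_kernel a t : R := (0 < t)%R%:R * (t `^ (a - 1) * expR (- t)).
Definition beta_kernel a b s : R :=
  (0 < s < 1)%R%:R * (s `^ (a - 1) * (1 - s) `^ (b - 1)).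

Lemma gamma_kernel_ge0 a t : 0 <= gamma_kernel a t.
Proof. by rewrite !mulr_ge0 ?powR_ge0 ?expR_ge0. Qed.

Lemma beta_kernel_ge0 a b s : 0 <= beta_kernel a b s.
Proof. by rewrite !mulr_ge0 ?powR_ge0. Qed.

Lemma beta_kernel_le0 a b s : s <= 0 -> beta_kernel a b s = 0.
Proof. by move=> s0; rewrite /beta_kernel ltNge s0 mul0r. Qed.

Lemma measurable_gamma_kernel a : measurable_fun [set: R] (gamma_kernel a).
Proof.
apply: measurable_funM; last first.
  by apply: measurable_funM; [exact: measurable_powR|exact: measurableT_comp].
have := measurable_in_itv `]0 : R, +oo[%R.
by under eq_fun do rewrite in_itv/= andbT.
Qed.

Lemma measurable_beta_kernel a b : measurable_fun [set: R] (beta_kernel a b).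
Proof.
apply: measurable_funM; last first.
  apply: measurable_funM; first exact: measurable_powR.
  apply: (@measurableT_comp _ _ _ _ _ _ (@powR R ^~ (b - 1))) => //.
  exact: measurable_funB.
have := measurable_in_itv `]0 : R, 1[%R.
by under eq_fun do rewrite in_itv/=.
Qed.

Definition eGamma a : \bar R := (\int[mu]_t (gamma_kernel a t)%:E)%E.
Definition eBeta a b : \bar R := (\int[mu]_s (beta_kernel a b s)%:E)%E.

Lemma eGamma_ge0 a : (0 <= eGamma a)%E.
Proof. by apply: integral_ge0 => t _; rewrite lee_fin gamma_kernel_ge0. Qed.

Lemma eBeta_ge0 a b : (0 <= eBeta a b)%E.
Proof. by apply: integral_ge0 => t _; rewrite lee_fin beta_kernel_ge0. Qed.

Lemma mul_gamma_kernel a b r s : 0 < r ->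
  gamma_kernel a (r * s) * gamma_kernel b (r - r * s) =
  r^-1 * gamma_kernel (a + b) r * beta_kernel a b s.
Proof.
move=> r0; rewrite /gamma_kernel /beta_kernel r0 pmulr_rgt0//.
have -> : (0 < r - r * s) = (s < 1) by rewrite subr_gt0 gtr_pMr.
have [s0|] := ltP 0 s; last by rewrite !mul0r !mulr0.
have [s1|] := ltP s 1; last by rewrite !mul0r !mulr0.
rewrite !mul1r (_ : r - r * s = r * (1 - s)); last by ring.
rewrite !powRM ?(ltW s0) ?(ltW r0)// ?subr_ge0 ?(ltW s1)//.
have -> : r `^ (a + b - 1) = r * (r `^ (a - 1) * r `^ (b - 1)).
  rewrite -(gt0_mulr_powRB1 (a + b - 1) r0) -powRD ?(gt_eqF r0) ?implybT//.
  by congr (_ * _ `^ _); ring.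
have -> : expR (- r) = expR (- (r * s)) * expR (- (r * (1 - s))).
  by rewrite -expRD; congr expR; ring.
by field; rewrite gt_eqF.
Qed.

Lemma gamma_kernel_convolution a b r :
  (\int[mu]_t (gamma_kernel a t * gamma_kernel b (r - t))%:E =
   (gamma_kernel (a + b) r)%:E * eBeta a b)%E.
Proof.
have [r0|r0] := ltP 0 r; last first.
  rewrite [gamma_kernel (a + b) r]/gamma_kernel ltNge r0 !mul0r mul0e.
  rewrite integral0_eq// => t _.
  rewrite /gamma_kernel; have [t0|] := ltP 0 t; last by rewrite !mul0r.
  by rewrite [0 < r - t]ltNge (_ : r - t <= 0) ?mul0r ?mulr0//; lra.
rewrite (ge0_integral_affine 0 r0)//; first last.
- by move=> x; rewrite lee_fin mulr_ge0 ?gamma_kernel_ge0.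
- apply/measurable_EFinP; apply: measurable_funM; first exact: measurable_gamma_kernel.
  apply: (@measurableT_comp _ _ _ _ _ _ (gamma_kernel b)).
    exact: measurable_gamma_kernel.
  exact: measurable_funB.
under eq_integral do rewrite addr0 mul_gamma_kernel// EFinM.
rewrite ge0_integralZl//.
- by rewrite muleA -EFinM mulVKf// gt_eqF.
- by apply/measurable_EFinP; exact: measurable_beta_kernel.
- by move=> x _; rewrite lee_fin beta_kernel_ge0.
- by rewrite lee_fin mulr_ge0 ?gamma_kernel_ge0 ?invr_ge0// ltW.
Qed.

Lemma eGamma_eBeta a b : (eGamma a * eGamma b = eGamma (a + b) * eBeta a b)%E.
Proof.
rewrite /eGamma -ge0_integral_convolution ?gamma_kernel_ge0//; first last.
- by move=> x; exact: gamma_kernel_ge0.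
- by move=> x; exact: gamma_kernel_ge0.
- exact: measurable_gamma_kernel.
- exact: measurable_gamma_kernel.
under eq_integral do rewrite gamma_kernel_convolution.
rewrite ge0_integralZr//.
- by apply/measurable_EFinP; exact: measurable_gamma_kernel.
- by move=> x _; rewrite lee_fin gamma_kernel_ge0.
- exact: eBeta_ge0.
Qed.

Lemma eGamma1 : eGamma 1 = 1%E.
Proof.
rewrite -(@integral_exponential_pdf R 1 ltr01) /eGamma.
transitivity (\int[mu]_(t in `]0%R, +oo[) (expR (- t))%:E)%E.
  rewrite integral_itv_mkcond; apply: eq_integral => t _.
  by rewrite /gamma_kernel in_itv/= andbT subrr powRr0 mul1r.
rewrite integral_itv_obnd_cbnd; last first.
  by apply/measurable_EFinP/measurable_funTS; apply: measurableT_comp.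
rewrite integral_mkcond; apply: eq_integral => t _; rewrite /exponential_pdf !patchE.
by case: ifP => // _; rewrite mul1r mulN1r.
Qed.

Lemma eBetar1 a : 0 < a -> eBeta a 1 = (a^-1)%:E.
Proof.
move=> a0; have powR_cont c x : 0 < x -> {for x, continuous (fun t : R => t `^ c)}.
  move=> x0; have d := is_derive1_powR c x0.
  exact/differentiable_continuous/derivable1_diffP.
pose F t := a^-1 * t `^ a.
have F_derive x : 0 < x -> is_derive x (1 : R) F (x `^ (a - 1)).
  move=> x0; have d := is_derive1_powR a x0.
  by apply: is_derive_eq; rewrite /GRing.scale/= mulKf// gt_eqF.
transitivity (\int[mu]_(t in `]0%R, 1%R]) (t `^ (a - 1))%:E)%E.
  rewrite -integral_itv_bndo_bndc; last first.
    by apply/measurable_EFinP/measurable_funTS; exact: measurable_powR.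
  rewrite integral_itv_mkcond; apply: eq_integral => t _.
  by rewrite /beta_kernel in_itv/= subrr powRr0 mulr1.
rewrite (@ge0_continuous_FTC2oc _ _ F _ _ 0)//.
- by rewrite /F powR1 mulr1 sube0.
- by move=> x _; exact: powR_ge0.
- apply: continuous_in_subspaceT => x; rewrite inE/= in_itv/= => /andP[x0 _].
  exact: powR_cont.
- by rewrite -[X in _ --> X](mulr0 a^-1); apply: cvgM; [exact: cvg_cst|exact: powR_cvg0].
- by move=> x; rewrite in_itv/= => /andP[x0 _]; have d := F_derive x x0.
- apply: cvg_at_left_filter; apply: cvgM; first exact: cvg_cst.
  exact: powR_cont.
- move=> x; rewrite in_itv/= => /andP[x0 _].
  by have d := F_derive x x0; rewrite derive1E derive_val.
Qed.

Lemma eGammaS a : 0 < a -> (eGamma a = eGamma (a + 1) * (a^-1)%:E)%E.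
Proof. by move=> a0; rewrite -eBetar1// -eGamma_eBeta eGamma1 mule1. Qed.

Lemma eGamma_natr_lty n : (eGamma (n.+1%:R : R) < +oo)%E.
Proof.
elim: n => [|n]; first by rewrite eGamma1 ltry.
have n0 : 0 < n.+1%:R :> R by rewrite ltr0n.
rewrite (eGammaS n0) natr1.
case: (eGamma _) (eGamma_ge0 (n.+2%:R : R)) => [r _ _|_|//]; first exact: ltry.
by rewrite gt0_mulye ?lte_fin ?invr_gt0.
Qed.

Lemma gamma_kernel_le a b t : 1 <= a <= b ->
  gamma_kernel a t <= gamma_kernel 1 t + gamma_kernel b t.
Proof.
move=> /andP[a1 ab]; rewrite /gamma_kernel.
have [t0|] := ltP 0 t; last by rewrite !mul0r addr0.
rewrite !mul1r -mulrDl ler_wpM2r ?expR_ge0//.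
have [t1|t1] := leP t 1.
  rewrite (@le_trans _ _ (t `^ (1 - 1)))//; last by rewrite lerDl powR_ge0.
  by apply: ger_powR; [rewrite t0|lra].
rewrite (@le_trans _ _ (t `^ (b - 1)))//; last by rewrite lerDr powR_ge0.
by apply: ler_powR; [exact: ltW|lra].
Qed.

Lemma eGamma_lty a : 0 < a -> (eGamma a < +oo)%E.
Proof.
wlog a1 : a / 1 <= a => [hwlog a0|_].
  have : (eGamma (a + 1) < +oo)%E by apply: hwlog; lra.
  rewrite (eGammaS a0); case: (eGamma _) (eGamma_ge0 (a + 1)) => [r _ _|//|//].
  exact: ltry.
pose n := Num.truncn a; have an : a < n.+1%:R by exact: truncnS_gt.
have mgamma b : measurable_fun [set: measurableTypeR R] (fun t => (gamma_kernel b t)%:E).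
  by apply/measurable_EFinP; exact: measurable_gamma_kernel.
have gamma_ge0 b t : (0 <= (gamma_kernel b t)%:E)%E by rewrite lee_fin gamma_kernel_ge0.
apply: (@le_lt_trans _ _ (eGamma 1 + eGamma n.+1%:R)%E); last first.
  by apply: lte_add_pinfty; [rewrite eGamma1 ltry|exact: eGamma_natr_lty].
rewrite /eGamma -ge0_integralD//; apply: ge0_le_integral => //.
  exact: emeasurable_funD.
by move=> t _; rewrite -EFinD lee_fin gamma_kernel_le// a1 ltW.
Qed.

Lemma eGammaE a : 0 < a -> eGamma a = (Gamma a)%:E.
Proof.
move=> a0; rewrite /Gamma /Rintegral integral_itv_mkcond.
under eq_integral do rewrite in_itv/= andbT -/(gamma_kernel a _).
by rewrite fineK// ge0_fin_numE ?eGamma_ge0// eGamma_lty.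
Qed.

Lemma Gamma_gt0 a : 0 < a -> 0 < Gamma a.
Proof.
move=> a0; rewrite -lte_fin -eGammaE//.
have mgamma : measurable_fun [set: measurableTypeR R] (fun t => (gamma_kernel a t)%:E).
  by apply/measurable_EFinP; exact: measurable_gamma_kernel.
apply: (@lt_le_trans _ _ (\int[mu]_(t in `[1%R, 2%R]) (expR (- 2) / 2)%:E)%E).
  rewrite integral_cst//= lebesgue_measure_itv/= lte_fin ltr1n -EFinB -EFinM lte_fin.
  by rewrite mulr_gt0 ?divr_gt0 ?expR_gt0//; lra.
apply: (@le_trans _ _ (\int[mu]_(t in `[1%R, 2%R]) (gamma_kernel a t)%:E)%E); last first.
  by apply: ge0_subset_integral => // t _; rewrite lee_fin gamma_kernel_ge0.
apply: ge0_le_integral => //; first exact: measurable_funTS.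
move=> t /=; rewrite in_itv/= => /andP[t1 t2]; have t0 : 0 < t by lra.
rewrite lee_fin /gamma_kernel t0 mul1r mulrC ler_pM ?expR_ge0//; last first.
  by rewrite ler_expR; lra.
apply: (@le_trans _ _ (t `^ (-1))); last by apply: ler_powR; lra.
by rewrite powR_inv1 ?(ltW t0)// lef_pV2 ?posrE.
Qed.

Lemma GammaS a : 0 < a -> Gamma (a + 1) = a * Gamma a.
Proof.
move=> a0; have := eGammaS a0; rewrite !eGammaE//; last by lra.
by rewrite -EFinM => -[->]; rewrite mulrCA mulfV ?mulr1// gt_eqF.
Qed.

Lemma Gamma_poch a n : 0 < a -> Gamma (a + n%:R) = poch a n * Gamma a.
Proof.
move=> a0; elim: n => [|n IHn]; first by rewrite addr0 poch0 mul1r.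
by rewrite -natr1 addrA GammaS ?IHn ?pochS; [ring|rewrite ltr_wpDr].
Qed.

Definition Beta a b : R := Gamma a * Gamma b / Gamma (a + b).

Lemma Beta_gt0 a b : 0 < a -> 0 < b -> 0 < Beta a b.
Proof. by move=> a0 b0; rewrite divr_gt0 ?mulr_gt0 ?Gamma_gt0 ?addr_gt0. Qed.

Lemma eBetaE a b : 0 < a -> 0 < b -> eBeta a b = (Beta a b)%:E.
Proof.
move=> a0 b0; have ab0 := addr_gt0 a0 b0; have Gab0 := Gamma_gt0 ab0.
have := eGamma_eBeta a b; rewrite !eGammaE// /Beta.
case: (eBeta a b) (eBeta_ge0 a b) => [r _|_|//]; last by rewrite gt0_muley ?lte_fin.
by rewrite -!EFinM => -[->]; congr EFin; rewrite mulrAC mulfV ?mul1r// gt_eqF.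
Qed.

Lemma Beta_poch a b n : 0 < a -> 0 < b ->
  Beta a (b + n%:R) = Beta a b * (poch b n / poch (a + b) n).
Proof.
move=> a0 b0; rewrite /Beta addrA !Gamma_poch ?addr_gt0//.
have /lt0r_neq0 := poch_gt0 n (addr_gt0 a0 b0).
have /lt0r_neq0 := Gamma_gt0 (addr_gt0 a0 b0).
move: (Gamma (a + b)) (poch (a + b) n) (Gamma a) (Gamma b) => x y z w x0 y0.
by field; rewrite x0 y0.
Qed.

Lemma exprn_mul_beta_kernel a b s n :
  s ^+ n * beta_kernel a b s = beta_kernel (a + n%:R) b s.
Proof.
rewrite /beta_kernel; have [/andP[s0 s1]|_] := boolP (0 < s < 1); last first.
  by rewrite !mul0r mulr0.
rewrite !mul1r mulrA -powR_mulrn ?ltW// -powRD ?(gt_eqF s0) ?implybT//.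
by congr (_ `^ _ * _); ring.
Qed.

Lemma beta_kernel_mul_exprn a b s n :
  beta_kernel a b s * (1 - s) ^+ n = beta_kernel a (b + n%:R) s.
Proof.
rewrite /beta_kernel; have [/andP[s0 s1]|_] := boolP (0 < s < 1); last first.
  by rewrite !mul0r.
have onem_gt0 : 0 < 1 - s by rewrite subr_gt0.
rewrite !mul1r -mulrA -powR_mulrn ?ltW// -powRD ?(gt_eqF onem_gt0) ?implybT//.
by congr (_ * _ `^ _); ring.
Qed.

Lemma integral_exprn_beta_kernel a b n : 0 < a -> 0 < b ->
  (\int[mu]_s (s ^+ n * beta_kernel a b s)%:E = (Beta (a + n%:R) b)%:E)%E.
Proof.
move=> a0 b0; under eq_integral do rewrite exprn_mul_beta_kernel.
by rewrite -/(eBeta _ _) eBetaE// ltr_wpDr.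
Qed.

Lemma integrable_beta_kernel a b : 0 < a -> 0 < b ->
  mu.-integrable [set: measurableTypeR R] (fun s => (beta_kernel a b s)%:E).
Proof.
move=> a0 b0; apply/integrableP; split.
  by apply/measurable_EFinP; exact: measurable_beta_kernel.
under eq_integral do rewrite gee0_abs ?lee_fin ?beta_kernel_ge0//.
by rewrite -/(eBeta a b) eBetaE// ltry.
Qed.

End gamma_and_beta_integrals.

Section beta_integral_of_power_series.
Context {R : realType}.
Local Notation mu := (@lebesgue_measure R).
Variables (a b y : R) (c : R^nat).
Hypotheses (a0 : 0 < a) (b0 : 0 < b) (y01 : 0 <= y < 1) (c1 : radius_ge1 c).

Let partial n s : \bar R := (beta_kernel a b s * pseries c (y * (1 - s)) n)%:E.
Let limit s : \bar R := (beta_kernel a b s * limn (pseries c (y * (1 - s))))%:E.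

Let scaled_in s : 0 < s < 1 -> 0 <= y * (1 - s) <= y.
Proof. by have /andP[y0 _] := y01; move=> /andP[s0 s1]; nra. Qed.

Lemma integral_beta_kernel_pseries_partial n :
  mu.-integrable [set: measurableTypeR R] (partial n) /\
  (\int[mu]_s partial n s = (Beta a b * pseries (beta_ratio a b c) y n)%:E)%E.
Proof.
elim: n => [|n [int_n IHn]].
  have -> : partial 0%N = cst 0%E.
    by apply/funext => s; rewrite /partial /pseries /series/= big_nil mulr0.
  by rewrite integral0 /pseries /series/= big_nil mulr0; split=> //; exact: integrable0.
have partialS : partial n.+1 =
    (partial n \+ (fun s => (c n * y ^+ n)%:E * (beta_kernel a (b + n%:R) s)%:E))%E.
  apply/funext => s; rewrite /partial -EFinM -EFinD /pseries seriesSr mulrDr.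
  by congr (_ + _)%:E; rewrite -beta_kernel_mul_exprn/= exprMn; ring.
have bn0 : 0 < b + n%:R by rewrite ltr_wpDr.
have int_term : mu.-integrable [set: measurableTypeR R]
    (fun s => (c n * y ^+ n)%:E * (beta_kernel a (b + n%:R) s)%:E)%E.
  by apply: integrableZl => //; exact: integrable_beta_kernel.
rewrite partialS; split; first exact: integrableD.
rewrite integralD// IHn integralZl//; last exact: integrable_beta_kernel.
rewrite -/(eBeta _ _) eBetaE// Beta_poch// -EFinM -EFinD /pseries seriesSr.
by rewrite /beta_ratio; congr EFin; rewrite /=; ring.
Qed.

Let partial_cvg s : partial n s @[n --> \oo] --> limit s.
Proof.
have [s01|s01] := boolP (0 < s < 1); last first.
  rewrite /partial /limit (_ : beta_kernel a b s = 0) ?mul0r; last first.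
    by rewrite /beta_kernel (negPf s01) mul0r.
  by under eq_fun do rewrite mul0r; exact: cvg_cst.
apply: cvg_EFin; first exact: nearW.
apply: cvgM; [exact: cvg_cst|apply: radius_ge1_cvg => //].
by have /andP[-> /le_lt_trans->//] := scaled_in s01; case/andP: y01.
Qed.

Let partial_le s n : (`|partial n s| <=
  (beta_kernel a b s)%:E * (limn (pseries (fun k => `|c k|) y))%:E)%E.
Proof.
rewrite -EFinM abse_EFin lee_fin normrM [`|beta_kernel _ _ _|]ger0_norm ?beta_kernel_ge0//.
have [s01|s01] := boolP (0 < s < 1); last by rewrite /beta_kernel (negPf s01) !mul0r.
rewrite ler_wpM2l ?beta_kernel_ge0// norm_pseries_le ?scaled_in//.
by case/andP: y01.
Qed.

Let limit_dominated : mu.-integrable [set: measurableTypeR R] limit /\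
  (\int[mu]_s partial n s)%E @[n --> \oo] --> (\int[mu]_s limit s)%E.
Proof.
have mpartial n : measurable_fun [set: measurableTypeR R] (partial n).
  by have [/integrableP[]] := integral_beta_kernel_pseries_partial n.
pose bound s := ((beta_kernel a b s)%:E * (limn (pseries (fun k => `|c k|) y))%:E)%E.
have [||||//] := @dominated_convergence _ _ _ mu setT measurableT
  partial limit bound mpartial.
- by apply: (emeasurable_fun_cvg partial) => // s _; exact: partial_cvg.
- by apply: aeW => s _; exact: partial_cvg.
- by apply: integrableZr => //; exact: integrable_beta_kernel.
- by apply: aeW => s n _; exact: partial_le.
Qed.

Lemma integrable_beta_kernel_pseries : mu.-integrable [set: measurableTypeR R]
  (fun s => (beta_kernel a b s * limn (pseries c (y * (1 - s))))%:E).
Proof. exact: limit_dominated.1. Qed.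

Lemma integral_beta_kernel_pseries :
  (\int[mu]_s (beta_kernel a b s * limn (pseries c (y * (1 - s))))%:E =
   (Beta a b * limn (pseries (beta_ratio a b c) y))%:E)%E.
Proof.
apply: cvg_unique limit_dominated.2 _ => //.
rewrite (funext (fun n => (integral_beta_kernel_pseries_partial n).2)).
apply: cvg_EFin; first exact: nearW.
apply: cvgM; [exact: cvg_cst|apply: radius_ge1_cvg => //].
exact: radius_ge1_beta_ratio (ltW b0) c1.
Qed.

End beta_integral_of_power_series.

Section power_series_at_one.
Context {R : realType}.
Local Notation mu := (@lebesgue_measure R).
Implicit Types (g w z s t x : R) (a : R^nat).

Definition onem_pseries g a x : R :=
  (0 < x < 1)%R%:R * ((1 - x) `^ (g - 1) * limn (pseries a (1 - x))).

Lemma onem_pseries_out g a x : ~~ (0 < x < 1) -> onem_pseries g a x = 0.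
Proof. by rewrite /onem_pseries => /negPf ->; rewrite mul0r. Qed.

Lemma onem_pseries_le0 g a x : x <= 0 -> onem_pseries g a x = 0.
Proof. by move=> x0; rewrite onem_pseries_out// ltNge x0. Qed.

Lemma measurable_onem_pseries g a :
  radius_ge1 a -> measurable_fun [set: R] (onem_pseries g a).
Proof.
move=> a1; have monem : measurable_fun [set: R] (fun x : R => 1 - x).
  exact: measurable_funB.
pose partial n (x : R) : R :=
  (0 < x < 1)%R%:R * ((1 - x) `^ (g - 1) * pseries a (1 - x) n).
apply: (@measurable_fun_cvg _ _ _ _ partial) => [n|x _].
  apply: measurable_funM.
    have := measurable_in_itv `]0 : R, 1[%R.
    by under eq_fun do rewrite in_itv/=.
  apply: measurable_funM.
    by apply: (@measurableT_comp _ _ _ _ _ _ (@powR R ^~ (g - 1))).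
  apply: measurable_sum => k; apply: measurable_funM => //.
  exact: measurable_funX.
rewrite /partial /onem_pseries; have [x01|_] := boolP (0 < x < 1); last first.
  by rewrite mul0r; under eq_fun do rewrite mul0r; exact: cvg_cst.
do 2 (apply: cvgM; first exact: cvg_cst).
by apply: radius_ge1_cvg => //; lra.
Qed.

Lemma lim_pseries_negbin_onem c x : 0 < x < 1 ->
  limn (pseries (negbin c) (1 - x)) = x `^ (- c).
Proof. by move=> x01; rewrite lim_pseries_negbin ?subKr//; lra. Qed.

Lemma beta_kernelE w g : beta_kernel w g = onem_pseries g (negbin (1 - w)).
Proof.
apply/funext => x; rewrite /beta_kernel /onem_pseries.
have [x01|_] := boolP (0 < x < 1); last by rewrite !mul0r.
by rewrite lim_pseries_negbin_onem// opprB [x `^ _ * _]mulrC.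
Qed.

(* The substitution maps ]0, 1[ onto ]x, 1[, off which the integrand vanishes. *)
Lemma mellin_integrand_onem_pseries g w z a x s (t := (1 - x) * s + x) :
  radius_ge1 a -> 0 < x < 1 ->
  onem_pseries g a t * (t^-1 * beta_kernel w (z - w) (x / t)) =
  x `^ (w - 1) * (1 - x) `^ (g + (z - w) - 2) * (beta_kernel (z - w) g s
    * limn (pseries (cauchyM (negbin (z - 1)) a) ((1 - x) * (1 - s)))).
Proof.
move=> a1 /andP[x0 x1]; have onem_x_gt0 : 0 < 1 - x by rewrite subr_gt0.
have onem_t : 1 - t = (1 - x) * (1 - s) by rewrite /t; ring.
have [/andP[s0 s1]|s01] := boolP (0 < s < 1); last first.
  rewrite [beta_kernel _ _ s]/beta_kernel (negPf s01) !mul0r mulr0.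
  have [/andP[t0 t1]|t01] := boolP (0 < t < 1); last by rewrite onem_pseries_out// mul0r.
  rewrite /beta_kernel ltr_pdivrMr// mul1r (_ : _ && _ = false) ?mul0r ?mulr0//.
  apply: contraNF s01 => /andP[_]; rewrite /t ltrDr pmulr_rgt0// => ->/=.
  by rewrite -subr_gt0 -(pmulr_rgt0 _ onem_x_gt0) -onem_t subr_gt0.
have onem_s_gt0 : 0 < 1 - s by rewrite subr_gt0.
have t1 : t < 1 by rewrite -subr_gt0 onem_t mulr_gt0.
have xt : x < t by rewrite /t ltrDr mulr_gt0.
have t0 := lt_trans x0 xt.
have xt01 : 0 < x / t < 1 by rewrite divr_gt0//= ltr_pdivrMr// mul1r.
rewrite -onem_t lim_pseries_cauchyM//; [|exact: radius_ge1_negbin|lra].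
rewrite lim_pseries_negbin_onem ?t0// /onem_pseries /beta_kernel xt01 t0 t1 s0 s1 !mul1r.
have -> : 1 - x / t = (1 - x) * s / t by rewrite /t in t0 *; field; rewrite gt_eqF.
rewrite onem_t !powRM ?mulr_ge0 ?invr_ge0 ?ltW//.
have -> : (1 - x) `^ (g + (z - w) - 2) = (1 - x) `^ (g - 1) * (1 - x) `^ (z - w - 1).
  by rewrite -powRD ?(gt_eqF onem_x_gt0) ?implybT//; congr (_ `^ _); ring.
have -> : t `^ (- (z - 1)) = t^-1 * (t^-1 `^ (w - 1) * t^-1 `^ (z - w - 1)).
  rewrite -(powR_inv1 (ltW t0)) -!powRrM -!powRD ?(gt_eqF t0) ?implybT//.
  by congr (_ `^ _); ring.
by ring.
Qed.

Lemma mellin_conv_onem_pseries g w z a x : 0 < g -> w < z -> radius_ge1 a ->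
  (forall t, 0 <= onem_pseries g a t) ->
  mellin_conv (onem_pseries g a) (beta_kernel w (z - w)) x =
  (Beta (z - w) g * onem_pseries (g + (z - w)) (beta_conv_coef g w z a) x)%:E.
Proof.
move=> g0 wz a1 ge0; have d0 : 0 < z - w by rewrite subr_gt0.
have pseries_le0 := @onem_pseries_le0 g a.
have kernel_le0 := @beta_kernel_le0 _ w (z - w).
have kernel_ge0 := beta_kernel_ge0 w (z - w).
have [x01|x01] := boolP (0 < x < 1); last first.
  rewrite onem_pseries_out// mulr0 [LHS]integral0_eq// => t _.
  have [/andP[t0 t1]|t01] := boolP (0 < t < 1); last by rewrite onem_pseries_out// mul0r.
  rewrite beta_kernelE [onem_pseries _ _ (x / t)]onem_pseries_out ?mulr0//.
  apply: contra x01; rewrite ltr_pdivrMr// mul1r pmulr_lgt0 ?invr_gt0//.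
  by move=> /andP[-> /lt_trans ->].
have /andP[x0 x1] := x01; have onem_x_gt0 : 0 < 1 - x by rewrite subr_gt0.
have onem_x01 : 0 <= 1 - x < 1 by lra.
have c1 : radius_ge1 (cauchyM (negbin (z - 1)) a).
  exact: radius_ge1_cauchyM (@radius_ge1_negbin _ _) a1.
rewrite /mellin_conv (ge0_integral_affine x onem_x_gt0); first last.
- by move=> t; rewrite lee_fin mellin_integrand_ge0.
- apply/measurable_EFinP; apply: measurable_mellin_integrandr => //.
  + exact: measurable_onem_pseries.
  + exact: measurable_beta_kernel.
under eq_integral do rewrite mellin_integrand_onem_pseries// EFinM.
rewrite integralZl//; last exact: integrable_beta_kernel_pseries.
rewrite integral_beta_kernel_pseries// -!EFinM; congr EFin.
rewrite /onem_pseries x01 mul1r /beta_conv_coef lim_pseries_cauchyM//; last 2 first.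
- exact: radius_ge1_negbin.
- exact: radius_ge1_beta_ratio (ltW g0) c1.
rewrite lim_pseries_negbin_onem// opprB -(gt0_mulr_powRB1 (g + (z - w) - 1) onem_x_gt0).
by rewrite (_ : g + (z - w) - 1 - 1 = g + (z - w) - 2); ring.
Qed.

End power_series_at_one.

Section beta_product_densities.
Context {R : realType}.
Local Notation mu := (@lebesgue_measure R).
Implicit Types (ps : seq (R * R)) (w z x : R) (n : nat).

Definition beta_prod_kernel ps : R -> R :=
  onem_pseries (sum_gaps ps) (beta_prod_coef ps).

Lemma beta_prod_kernel1 w z : beta_prod_kernel [:: (w, z)] = beta_kernel w (z - w).
Proof.
rewrite /beta_prod_kernel beta_prod_coef1 beta_kernelE sum_gaps_cons.
by rewrite /sum_gaps big_nil add0r.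
Qed.

Lemma beta_prod_kernel_le0 ps x : x <= 0 -> beta_prod_kernel ps x = 0.
Proof. exact: onem_pseries_le0. Qed.

Lemma measurable_beta_prod_kernel ps :
  beta_params ps -> measurable_fun [set: R] (beta_prod_kernel ps).
Proof. by move=> /radius_ge1_beta_prod_coef; exact: measurable_onem_pseries. Qed.

Lemma mellin_conv_beta_prod_kernel w z p ps x : w < z -> beta_params (p :: ps) ->
  (forall t, 0 <= beta_prod_kernel (p :: ps) t) ->
  mellin_conv (beta_prod_kernel (p :: ps)) (beta_kernel w (z - w)) x =
  (Beta (z - w) (sum_gaps (p :: ps)) * beta_prod_kernel [:: (w, z), p & ps] x)%:E.
Proof.
move=> wz psP ge0; rewrite /beta_prod_kernel mellin_conv_onem_pseries ?sum_gaps_gt0//.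
  by rewrite [sum_gaps [:: _, _ & _]]sum_gaps_cons.
exact: radius_ge1_beta_prod_coef.
Qed.

Lemma beta_prod_kernel_ge0 p ps x :
  beta_params (p :: ps) -> 0 <= beta_prod_kernel (p :: ps) x.
Proof.
elim: ps p x => [|p' ps IHps] [w z] x /= /andP[/andP[w0 wz] psP].
  by rewrite beta_prod_kernel1 beta_kernel_ge0.
have gap_gt0 : 0 < sum_gaps (p' :: ps) by exact: sum_gaps_gt0.
have B0 : 0 < Beta (z - w) (sum_gaps (p' :: ps)) by rewrite Beta_gt0// subr_gt0.
have ge0 t : 0 <= beta_prod_kernel (p' :: ps) t by exact: IHps.
rewrite -(pmulr_rge0 _ B0) -lee_fin -mellin_conv_beta_prod_kernel//.
apply: mellin_conv_ge0 => //; first exact: beta_kernel_ge0.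
exact: beta_prod_kernel_le0.
Qed.

Lemma exprn_mul_beta_prod_kernel_ge0 p ps x n :
  beta_params (p :: ps) -> 0 <= x ^+ n * beta_prod_kernel (p :: ps) x.
Proof.
move=> psP; apply: exprn_mul_ge0 => t; first exact: beta_prod_kernel_ge0.
exact: beta_prod_kernel_le0.
Qed.

Lemma integral_exprn_beta_prod_kernel_cons w z p ps n (g := sum_gaps (p :: ps)) :
  0 < w < z -> beta_params (p :: ps) ->
  ((Beta (z - w) g)%:E *
   \int[mu]_x (x ^+ n * beta_prod_kernel [:: (w, z), p & ps] x)%:E =
   \int[mu]_x (x ^+ n * beta_prod_kernel (p :: ps) x)%:E *
   (Beta (w + n%:R) (z - w))%:E)%E.
Proof.
move=> /andP[w0 wz] psP; have d0 : 0 < z - w by rewrite subr_gt0.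
have consP : beta_params [:: (w, z), p & ps] by rewrite /= w0 wz.
have ge0 t : 0 <= beta_prod_kernel (p :: ps) t by exact: beta_prod_kernel_ge0.
rewrite -integral_exprn_beta_kernel// -integral_exprn_mellin_conv//; first last.
- exact: beta_kernel_le0.
- exact: beta_prod_kernel_le0.
- exact: beta_kernel_ge0.
- exact: measurable_beta_kernel.
- exact: measurable_beta_prod_kernel.
rewrite -ge0_integralZl//.
- by apply: eq_integral => x _; rewrite mellin_conv_beta_prod_kernel// -!EFinM mulrCA.
- apply/measurable_EFinP; apply: measurable_exprn_mul.
  exact: measurable_beta_prod_kernel.
- by move=> x _; rewrite lee_fin exprn_mul_beta_prod_kernel_ge0.
- by rewrite lee_fin ltW// Beta_gt0// sum_gaps_gt0.
Qed.

Lemma integral_exprn_beta_prod_kernel p ps n : beta_params (p :: ps) ->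
  (\int[mu]_x (x ^+ n * beta_prod_kernel (p :: ps) x)%:E =
  (Gamma (sum_gaps (p :: ps)) *
   \prod_(q <- p :: ps) (Gamma (q.1 + n%:R) / Gamma (q.2 + n%:R)))%:E)%E.
Proof.
elim: ps p => [|p' ps IHps] [w z]; rewrite beta_params_cons => /andP[wzP psP];
  have /andP[w0 wz] := wzP; have d0 : 0 < z - w by rewrite subr_gt0.
  rewrite beta_prod_kernel1 integral_exprn_beta_kernel// big_seq1 /Beta.
  rewrite sum_gaps_cons /sum_gaps big_nil add0r.
  rewrite (_ : w + n%:R + (z - w) = z + n%:R); last by ring.
  by congr EFin; rewrite -mulrA mulrCA.
have g0 : 0 < sum_gaps (p' :: ps) by exact: sum_gaps_gt0.
have /lt0r_neq0 B_neq0 := Beta_gt0 d0 g0.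
have := integral_exprn_beta_prod_kernel_cons n wzP psP; rewrite IHps// => momentE.
rewrite -[LHS]mul1e -[X in (X%:E * _)%E](mulVf B_neq0) EFinM -muleA momentE -!EFinM.
congr EFin.
rewrite [in RHS]big_cons sum_gaps_cons [sum_gaps _ + _]addrC /Beta.
rewrite (_ : w + n%:R + (z - w) = z + n%:R)/=; last by ring.
move: (Gamma_gt0 d0) (Gamma_gt0 g0) (Gamma_gt0 (addr_gt0 d0 g0)).
move: (Gamma (z - w)) (Gamma (sum_gaps _)) (Gamma (_ + sum_gaps _)) => Gd Gg Gdg.
move: (Gamma (w + _)) (Gamma (z + _))^-1 (\prod_(_ <- _) _) => Gw Gz_inv P.
by move=> /lt0r_neq0 Gd0 /lt0r_neq0 Gg0 /lt0r_neq0 Gdg0; field; rewrite Gd0 Gg0 Gdg0.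
Qed.

End beta_product_densities.

Section beta_product_pdf.
Context {R : realType} {m : nat} (u v : 'I_m -> R).
Local Notation mu := (@lebesgue_measure R).
Hypotheses (m0 : (0 < m)%N) (u0 : forall i, 0 < u i) (uv : forall i, u i < v i).
Implicit Types (x : R) (n : nat).

Let v0 i : 0 < v i. Proof. exact: lt_trans (uv i). Qed.

Definition beta_product_const : R :=
  (Gamma (delta u v))^-1 * \prod_(i < m) (Gamma (v i) / Gamma (u i)).

(* At x = 0 the series may diverge, and [limn] is then a junk value. *)
Definition beta_product_pdf x : R :=
  if 0 < x then
    beta_product_const * (1 - x) `^ (delta u v - 1) * limn (pseries (cc u v) (1 - x))
  else 0.

Let ps := [seq (u i, v i) | i <- enum 'I_m].

Let psP : beta_params ps.
Proof. by apply/allP => _ /mapP[i _ ->]; rewrite /= u0 uv. Qed.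

Let ps_cons : exists p ps', ps = p :: ps'.
Proof.
case psE : ps => [|p ps']; last by exists p, ps'.
by move: m0; rewrite -(size_enum_ord m) -(size_map (fun i => (u i, v i))) -/ps psE.
Qed.

Let sum_gaps_ps : sum_gaps ps = delta u v.
Proof. by rewrite /sum_gaps big_map big_enum. Qed.

Let gap_gt0 : 0 < delta u v. Proof. exact: delta_gt0. Qed.

Lemma radius_ge1_cc : radius_ge1 (cc u v).
Proof.
by rewrite -(beta_prod_coef_cc m0 gap_gt0 psP); exact: radius_ge1_beta_prod_coef.
Qed.

Lemma beta_product_const_ge0 : 0 <= beta_product_const.
Proof.
rewrite mulr_ge0 ?invr_ge0 ?ltW ?Gamma_gt0// prodr_gt0// => i _.
by rewrite divr_gt0 ?Gamma_gt0.
Qed.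

Let beta_product_pdfE x : 0 < x < 1 ->
  beta_product_pdf x = beta_product_const * beta_prod_kernel ps x.
Proof.
move=> x01; have /andP[x0 _] := x01.
rewrite /beta_product_pdf x0 /beta_prod_kernel (beta_prod_coef_cc m0 gap_gt0 psP).
by rewrite sum_gaps_ps /onem_pseries x01 mul1r mulrA.
Qed.

Lemma beta_product_pdf_ge0 x : 0 <= x <= 1 -> 0 <= beta_product_pdf x.
Proof.
move=> /andP[x0]; rewrite le_eqVlt => /predU1P[->|x1].
  rewrite /beta_product_pdf ltr01 subrr lim_pseries0 mulr1.
  by rewrite mulr_ge0 ?beta_product_const_ge0 ?powR_ge0.
have [x_gt0|x_le0] := ltP 0 x; last by rewrite /beta_product_pdf ltNge x_le0.
rewrite beta_product_pdfE ?x_gt0// mulr_ge0 ?beta_product_const_ge0//.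
by have [p [ps' psE]] := ps_cons; rewrite psE beta_prod_kernel_ge0// -psE.
Qed.

Lemma measurable_beta_product_pdf : measurable_fun (`[0, 1] : set R) beta_product_pdf.
Proof.
apply: (@measurable_fun_itv_cc _ _ _ false true).
apply: (@eq_measurable_fun _ _ _ _ _
  (fun x => beta_product_const * beta_prod_kernel ps x)).
  by move=> x; rewrite inE/= in_itv/= => x01; rewrite beta_product_pdfE.
apply: measurable_funTS; apply: measurable_funM => //.
exact: measurable_beta_prod_kernel.
Qed.

Lemma beta_product_const_moment n :
  beta_product_const * (Gamma (delta u v) *
    \prod_(i < m) (Gamma (u i + n%:R) / Gamma (v i + n%:R))) =
  \prod_(i < m) (poch (u i) n / poch (v i) n).
Proof.
have Gdelta_neq0 : Gamma (delta u v) != 0 by rewrite gt_eqF// Gamma_gt0.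
rewrite /beta_product_const mulrACA mulVf// mul1r -big_split/=.
apply: eq_bigr => i _; rewrite !Gamma_poch//.
have /lt0r_neq0 := Gamma_gt0 (u0 i); have /lt0r_neq0 := Gamma_gt0 (v0 i).
have /lt0r_neq0 := poch_gt0 n (v0 i).
move: (Gamma (u i)) (Gamma (v i)) (poch (v i) n) => Gu Gv p p0 Gv0 Gu0.
by field; rewrite Gu0 Gv0 p0.
Qed.

Lemma integral_exprn_beta_product_pdf n :
  (\int[mu]_(x in `[0%R, 1%R]) (x ^+ n * beta_product_pdf x)%:E =
   (\prod_(i < m) (poch (u i) n / poch (v i) n))%:E)%E.
Proof.
have [p [ps' psE]] := ps_cons; have psP' : beta_params (p :: ps') by rewrite -psE.
have mkernel := measurable_exprn_mul n (measurable_beta_prod_kernel psP).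
rewrite integral_itv_bndoo; last first.
  apply/measurable_EFinP; apply: measurable_funM.
    by apply: measurable_funTS; exact: exprn_measurable.
  apply: measurable_funS measurable_beta_product_pdf => //.
  by move=> x; exact: subset_itv_oo_cc.
transitivity (beta_product_const%:E * \int[mu]_x (x ^+ n * beta_prod_kernel ps x)%:E)%E.
  rewrite -ge0_integralZl//; first last.
  - by rewrite lee_fin beta_product_const_ge0.
  - by move=> x _; rewrite lee_fin psE exprn_mul_beta_prod_kernel_ge0.
  - exact/measurable_EFinP.
  rewrite integral_itv_mkcond; apply: eq_integral => x _; rewrite in_itv/= -EFinM.
  have [x01|x01] := boolP (0 < x < 1); first by rewrite mul1r beta_product_pdfE// mulrCA.
  by rewrite mul0r [beta_prod_kernel _ _]onem_pseries_out// !mulr0.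
rewrite {1}psE integral_exprn_beta_prod_kernel// -psE -EFinM sum_gaps_ps.
by rewrite big_map big_enum/= beta_product_const_moment.
Qed.

Lemma integral_beta_product_pdf :
  (\int[mu]_(x in `[0%R, 1%R]) (beta_product_pdf x)%:E = 1%:E)%E.
Proof.
have := integral_exprn_beta_product_pdf 0; under eq_integral do rewrite expr0 mul1r.
by move=> ->; rewrite big1// => i _; rewrite !poch0 divr1.
Qed.

Lemma integrable_beta_product_pdf :
  mu.-integrable `[0%R, 1%R] (EFin \o beta_product_pdf).
Proof.
apply/integrableP; split.
  by apply/measurable_EFinP; exact: measurable_beta_product_pdf.
under eq_integral => x /[!inE]/= x01.
  rewrite ger0_norm; last by apply: beta_product_pdf_ge0; rewrite in_itv in x01.
  over.
by rewrite integral_beta_product_pdf ltry.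
Qed.

Lemma cvg_series_cc x : 0 < x <= 1 ->
  series (fun n => cc u v n.+1 * (1 - x) ^+ n.+1) @ \oo -->
  limn (pseries (cc u v) (1 - x)) - 1.
Proof.
by move=> x01; apply: (pseries_tail (radius_ge1_cvg radius_ge1_cc _)); lra.
Qed.

End beta_product_pdf.

Theorem mainTheorem5 (R : realType) (m : nat) (u v : 'I_m -> R)
  (hm : (1 <= m)%N)
  (hu : forall i, 0 < u i) (huv : forall i, u i < v i) :
  exists f : R -> R,
    (* f is a density function on [0,1] *)
    (forall x : R, 0 <= x <= 1 -> 0 <= f x) /\
    (@lebesgue_measure R).-integrable `[0%R, 1%R] (EFin \o f) /\
    (\int[@lebesgue_measure R]_(x in `[0%R, 1%R]) (f x)%:E = 1%:E)%E /\
    (* moment sequence *)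
    (forall n : nat,
       (\int[@lebesgue_measure R]_(x in `[0%R, 1%R]) (x ^+ n * f x)%:E)%E
       = (\prod_(i < m) (poch (u i) n / poch (v i) n))%:E) /\
    (* series representation *)
    (forall x : R, 0 < x <= 1 ->
       cvgn (series (fun n => cc u v n.+1 * (1 - x) ^+ n.+1)) /\
       f x = (Gamma (delta u v))^-1 * (\prod_(i < m) (Gamma (v i) / Gamma (u i)))
             * (1 - x) `^ (delta u v - 1)
             * (1 + limn (series (fun n => cc u v n.+1 * (1 - x) ^+ n.+1)))).
Proof.
exists (beta_product_pdf u v); split; first by move=> x; exact: beta_product_pdf_ge0.
split; first exact: integrable_beta_product_pdf.
split; first exact: integral_beta_product_pdf.
split; first by move=> n; exact: integral_exprn_beta_product_pdf.
move=> x x01; have cvg_tail := cvg_series_cc hm hu huv x01.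
split; first exact: cvgP cvg_tail.
by rewrite (cvg_lim _ cvg_tail)// subrKC /beta_product_pdf; case/andP: x01 => ->.
Qed.
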